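(* Let $\mathcal{P}=\{p_1,\dots,p_m\}\subset\mathbb{R}^n$ and let $(\mathcal{S}^0,x^0)$, $\mathcal{S}^0\subseteq\mathcal{P}$, be a dual feasible S-pair from which the algorithm is started. The proposed dual algorithm, i.e. the procedure written out in the context, solves problem $Inf_{\mathcal{Q}}(\mathcal{P})$ in a finite number of iterations.
   Context: Notation. Vectors of $\mathbb{R}^n$ are written $x=(x_0;\bar x)$ with $x_0\in\mathbb{R}$, $\bar x\in\mathbb{R}^{n-1}$; $\|\cdot\|$ is the Euclidean norm. The second-order cone is $\mathcal{Q}=\{x\in\mathbb{R}^n:\|\bar x\|\le x_0\}$, and $x\preceq_{\mathcal{Q}}p$ means $p-x\in\mathcal{Q}$, i.e. $\|\bar p-\bar x\|\le p_0-x_0$. $Inf_{\mathcal{Q}}(\mathcal{P})$ is the problem: maximize $x_0$ subject to $x\preceq_{\mathcal{Q}}p_i$, $i=1,\dots,m$. Its optimal solution exists and is unique. For $\mathcal{S}\subseteq\mathcal{P}$, $\overline{\mathcal{S}}=\{\bar p:p\in\mathcal{S}\}$. A subset $\mathcal{S}$ is a support set if no proper subset $\mathcal{S}'$ of $\mathcal{S}$ satisfies $Inf_{\mathcal{Q}}(\mathcal{S}')=Inf_{\mathcal{Q}}(\mathcal{S})$; it is an optimal support set if moreover $Inf_{\mathcal{Q}}(\mathcal{S})=Inf_{\mathcal{Q}}(\mathcal{P})$. Dual feasible S-pair. For $\mathcal{S}\subseteq\mathcal{P}$ and a vector $x$, $(\mathcal{S},x)$ is a dual feasible S-pair if (a)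 $\|\bar p-\bar x\|=p_0-x_0$ for all $p\in\mathcal{S}$; (b) $\bar x\in\operatorname{ri}\operatorname{conv}(\overline{\mathcal{S}})$; (c) $\overline{\mathcal{S}}$ is affinely independent. (For example $(\{p\},p)$ for any $p\in\mathcal{P}$.) Quantities attached to the current $\mathcal{S}^j=\{p_{j_1},\dots,p_{j_s}\}$ and a point $p^*$. If $s>1$: $M=[\bar p_{j_2}-\bar p_{j_1},\dots,\bar p_{j_s}-\bar p_{j_1}]$; $c$ is the vector with entries $p_{j_i0}-p_{j_10}$ and $b$ the vector with entries $\frac12(\|\bar p_{j_i}\|^2-p_{j_i0}^2-\|\bar p_{j_1}\|^2+p_{j_10}^2)$, $i=2,\dots,s$; $M^+=(M^TM)^{-1}M^T$; $u=(M^TM)^{-1}(b-M^T\bar p_{j_1})$; $v=(M^TM)^{-1}c$; $w=-M^+(\bar p^*-\bar p_{j_1})$; $z=(I-MM^+)(\bar p^*-\bar p_{j_1})$. If $s=1$: $M,b,c,u,v,w$ are empty (terms containing them are zero) and $z=\bar p^*-\bar p_{j_1}$. The set $\overline{\mathcal{S}^j}\cup\{\bar p^*\}$ is affinely dependent exactly when $z=0$. Let $\mathbf 1$ be the all-ones vector of length $s-1$. When $z\ne0$ define $\alpha^{*+}(x_0)=\frac1{\|z\|}\sqrt{(p_{j_10}-x_0)^2-\|M(u+x_0v)\|^2}$, $\alpha_1(x_0)=1-\mathbf 1^T(u+x_0v)-\alpha^{*+}(x_0)(\mathbf 1^Tw+1)$, $(\alpha_2(x_0),\dots,\alpha_s(x_0))^T=u+x_0v+\alpha^{*+}(x_0)\,w$,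 $\Gamma^+(x_0)=M(u+x_0v)+\alpha^{*+}(x_0)\,z+\bar p_{j_1}$. The curve $x_0\mapsto(x_0;\Gamma^+(x_0))$, $x_0\le\min_i p_{j_i0}$, consists of points $x$ with $\|\bar p_{j_i}-\bar x\|=p_{j_i0}-x_0$ for all $i$ and $\bar x=\sum_i\alpha_i(x_0)\bar p_{j_i}+\alpha^{*+}(x_0)\bar p^*$, an affine combination. Partial step procedure. For $i=1,\dots,s$ let $\mathcal{A}_i$ be the set of real solutions $\delta$ of $\alpha_i(\delta)=0$ with $\delta\le x_0^j$. Put $x_0^{partial}=\max\bigcup_i\mathcal{A}_i$ and let $k$ be an index with $x_0^{partial}\in\mathcal{A}_k$ (the corresponding point of $\mathcal{S}^j$ is denoted $p_k$). Full step procedure. Let $c^*=p^*_0-p_{j_10}$, $b^*=\frac12(\|\bar p^*\|^2-(p_0^* )^2-\|\bar p_{j_1}\|^2+p_{j_10}^2)$, $d=\bar p^*-\bar p_{j_1}$, $\alpha^*(x_0)=\frac{1}{d^Tz}\big(b^*+x_0c^*-d^T(M(u+x_0v)+\bar p_{j_1})\big)$, $q=Mu+\frac{b^*-d^T(Mu+\bar p_{j_1})}{d^Tz}z$, $r=Mv+\frac{c^*-d^TMv}{d^Tz}z$. Let $\mathcal{A}^*$ be the set of real solutions $\delta$ of $\|q+\delta r\|^2=(p_{j_10}-\delta)^2$ satisfying $\alpha^*(\delta)\ge0$, $\delta\le p_0^*$ and $\delta\le x_0^j$. Put $x_0^{full}=\max\mathcal{A}^*$, or $x_0^{full}=-\infty$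 if $\mathcal{A}^*=\emptyset$. Affinely dependent case procedure. Let $\rho=\big(1-\mathbf 1^T(u+x_0^jv);\,u+x_0^jv\big)$ and $\sigma=\big(-1-\mathbf 1^Tw;\,w\big)$, vectors of length $s$. Let $k$ be such that $-\rho_k/\sigma_k=\min\{-\rho_i/\sigma_i:\ 1\le i\le s,\ \sigma_i<0\}$; the corresponding point of $\mathcal{S}^j$ is denoted $p_k$. The proposed dual algorithm. Input: $\mathcal{P}$ and a dual feasible S-pair $(\mathcal{S}^0,x^0)$, $\mathcal{S}^0\subseteq\mathcal{P}$. For $j=0,1,2,\dots$: 1. Optimality check: if $x^j\preceq_{\mathcal{Q}}p_i$ for all $p_i\in\mathcal{P}$, stop; $x^j$ is returned as the optimal solution and $\mathcal{S}^j$ as an optimal support set. Otherwise take some $p^*\in\mathcal{P}$ whose constraint is violated at $x^j$. 2. Check whether $p^*$ is the solution of $Inf_{\mathcal{Q}}(\mathcal{S}^j\cup\{p^*\})$: if $p^*\preceq_{\mathcal{Q}}p$ for all $p\in\mathcal{S}^j$, set $x^{j+1}=p^*$, $\mathcal{S}^{j+1}=\{p^*\}$, and go to step 1 (with $j+1$). 3. (Optional) If $|\mathcal{S}^j|=1$, say $\mathcal{S}^j=\{p_{j_1}\}$, set $x_0^{j+1}=\min\big(p_{j_10},p^*_0,\frac12(p_{j_10}+p^*_0-\|\bar p_{j_1}-\bar p^*\|)\big)$, $\bar x^{j+1}=\frac{(p_{j_10}-x_0^{j+1})\bar p^*+(p^*_0-x_0^{j+1})\bar p_{j_1}}{(p_{j_10}-x_0^{j+1})+(p^*_0-x_0^{j+1})}$,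 $\mathcal{S}^{j+1}=\mathcal{S}^j\cup\{p^*\}$, and go to step 1 (with $j+1$). 4. If $\|z\|=0$ (i.e. $\overline{\mathcal{S}^j}\cup\{\bar p^*\}$ is affinely dependent), get $p_k$ from the affinely dependent case procedure and replace $\mathcal{S}^j$ by $\mathcal{S}^j\setminus\{p_k\}$. 5. Curve search: compute $M,b,c,u,v,w,z$ for the current $\mathcal{S}^j$, then $x_0^{partial}$ (and $p_k$) and $x_0^{full}$ by the two step procedures. – If $x_0^{partial}\ge x_0^{full}$: set $x_0^j\leftarrow x_0^{partial}$, $\bar x^j\leftarrow\Gamma^+(x_0^j)$, $\mathcal{S}^j\leftarrow\mathcal{S}^j\setminus\{p_k\}$, and repeat step 5. – Otherwise: set $x_0^{j+1}\leftarrow x_0^{full}$, $\bar x^{j+1}\leftarrow\Gamma^+(x_0^{j+1})$, $\mathcal{S}^{j+1}\leftarrow\mathcal{S}^j\cup\{p^*\}$, and go to step 1 (with $j+1$).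
   Formalization: Partial steps can remove every point of S^j, and step 5 is then undefined, so the procedure as written can get stuck. The formal algorithm adds a rule: if S^j is empty during the curve search, set x^{j+1}=p*, S^{j+1}={p*} and return to step 1. *)

(* Defs.v *)
From HB Require Import structures.
From mathcomp Require Import all_boot all_order all_algebra finmap.
From mathcomp Require Import boolp classical_sets reals constructive_ereal.
From Stdlib Require Import Relation_Operators.

Set Implicit Arguments.
Unset Strict Implicit.
Unset Printing Implicit Defensive.

Import Order.TTheory GRing.Theory Num.Theory.
Local Open Scope ring_scope.

(* A point x = (x_0; \bar x) of R^n, n = 1 + d, is a column vector of type     *)
(* 'cV[R]_(1 + d).  The norm of MathComp-Analysis on matrices is the sup norm, *)
(* hence the Euclidean norm [enorm] below.                                     *)

Section Euclid.
Variables (R : realType) (d : nat).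
Implicit Types (x y : 'cV[R]_d) (A : set 'cV[R]_d).

Definition dot x y : R := (x^T *m y) 0 0.
Definition enorm x : R := Num.sqrt (dot x x).

Definition conv_hull A : set 'cV[R]_d :=
  [set x | exists k (a : 'I_k -> 'cV[R]_d) (l : 'I_k -> R),
     [/\ forall i, A (a i), forall i, 0 <= l i, \sum_i l i = 1
       & x = \sum_i l i *: a i]]%classic.

Definition aff_hull A : set 'cV[R]_d :=
  [set x | exists k (a : 'I_k -> 'cV[R]_d) (l : 'I_k -> R),
     [/\ forall i, A (a i), \sum_i l i = 1 & x = \sum_i l i *: a i]]%classic.

Definition rel_interior A : set 'cV[R]_d :=
  [set x | A x /\ exists2 e, 0 < e &
     forall y, aff_hull A y -> enorm (y - x) < e -> A y]%classic.

Definition affinely_independent (B : {fset 'cV[R]_d}) : Prop :=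
  forall l : 'cV[R]_d -> R,
    \sum_(a <- B) l a = 0 -> \sum_(a <- B) l a *: a = 0 ->
    forall a, a \in B -> l a = 0.

End Euclid.

Section Problem.
Variables (R : realType) (d : nat).
Local Notation V := 'cV[R]_(1 + d).
Implicit Types (x y p : V) (S P : {fset V}).

Definition hd x : R := x 0 0.
Definition bar x : 'cV[R]_d := dsubmx x.
Definition mkpt (x0 : R) (xbar : 'cV[R]_d) : V := col_mx x0%:M xbar.

Definition in_soc x : bool := enorm (bar x) <= hd x.
Definition soc_le x p : bool := in_soc (p - x).

Definition Inf_feasible S x : Prop := forall p, p \in S -> soc_le x p.

(* The set of optimal solutions: equality of two problems Inf(S) = Inf(S')     *)
(* means that they have the same solutions.  Inf(fset0) is unbounded, so its   *)
(* solution set is empty.                                                      *)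
Definition Inf S : set V :=
  [set x | Inf_feasible S x /\ forall y, Inf_feasible S y -> hd y <= hd x]%classic.

Definition support_set S : Prop :=
  forall S', (S' `<` S)%fset -> Inf S' <> Inf S.

Definition optimal_support_set P S : Prop :=
  [/\ (S `<=` P)%fset, support_set S & Inf S = Inf P].

Definition bars S : {fset 'cV[R]_d} := [fset bar p | p in S]%fset.

Definition dual_feasible_pair S x : Prop :=
  [/\ forall p, p \in S -> enorm (bar p - bar x) = hd p - hd x,
      rel_interior (conv_hull [set` bars S]) (bar x)
    & affinely_independent (bars S)].

End Problem.

Definition csum (R : realType) (s : nat) (y : 'cV[R]_s) : R := \sum_i y i 0.

Definition is_max (R : realType) (A : set R) (m : R) : Prop :=
  A m /\ forall y, A y -> y <= m.

Definition is_max_or_ninfty (R : realType) (A : set R) (m : \bar R) : Prop :=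
  (A = set0 /\ m = -oo%E) \/ (exists2 a, is_max A a & m = a%:E).

(* [t] enumerates the current support set, whose size is s.+1; its matrix has  *)
(* s columns.  For s = 0 all matrices below are empty, so that the terms       *)
(* containing them vanish.                                                     *)
Section Quantities.
Variables (R : realType) (d s : nat).
Local Notation V := 'cV[R]_(1 + d).
Variables (t : s.+1.-tuple V) (pstar : V).

Definition pt (i : 'I_s.+1) : V := tnth t i.
Definition pfst : V := pt ord0.
Definition pnext (i : 'I_s) : V := pt (lift ord0 i).

Definition half_gap (p : V) : R :=
  (enorm (bar p) ^+ 2 - hd p ^+ 2 - enorm (bar pfst) ^+ 2 + hd pfst ^+ 2) / 2.

Definition Mmx : 'M[R]_(d, s) := \matrix_(k, i) (bar (pnext i) - bar pfst) k 0.
Definition cvec : 'cV[R]_s := \col_i (hd (pnext i) - hd pfst).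
Definition bvec : 'cV[R]_s := \col_i half_gap (pnext i).

Definition Gram_inv : 'M[R]_s := invmx (Mmx^T *m Mmx).
Definition Mplus : 'M[R]_(s, d) := Gram_inv *m Mmx^T.
Definition uvec : 'cV[R]_s := Gram_inv *m (bvec - Mmx^T *m bar pfst).
Definition vvec : 'cV[R]_s := Gram_inv *m cvec.
Definition dvec : 'cV[R]_d := bar pstar - bar pfst.
Definition wvec : 'cV[R]_s := - (Mplus *m dvec).
Definition zvec : 'cV[R]_d := (1%:M - Mmx *m Mplus) *m dvec.

Definition uxv (x0 : R) : 'cV[R]_s := uvec + x0 *: vvec.

Definition radicand (x0 : R) : R :=
  (hd pfst - x0) ^+ 2 - enorm (Mmx *m uxv x0) ^+ 2.
Definition alpha_plus (x0 : R) : R := (enorm zvec)^-1 * Num.sqrt (radicand x0).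
Definition alpha (x0 : R) : 'cV[R]_(1 + s) :=
  col_mx (1 - csum (uxv x0) - alpha_plus x0 * (csum wvec + 1))%:M
         (uxv x0 + alpha_plus x0 *: wvec).
Definition Gamma_plus (x0 : R) : 'cV[R]_d :=
  Mmx *m uxv x0 + alpha_plus x0 *: zvec + bar pfst.

(* [Num.sqrt] is 0 on negative numbers: a real solution of alpha_i(delta) = 0  *)
(* must lie in the domain of the square root.                                  *)
Definition partial_set (x0 : R) (i : 'I_s.+1) : set R :=
  [set delta | [/\ 0 <= radicand delta, alpha delta i 0 = 0 & delta <= x0]]%classic.

Definition is_partial (x0 xp : R) : Prop :=
  is_max [set delta | exists i, partial_set x0 i delta]%classic xp.

Definition cstar : R := hd pstar - hd pfst.
Definition bstar : R := half_gap pstar.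
Definition dz : R := dot dvec zvec.
Definition alpha_star (x0 : R) : R :=
  dz^-1 * (bstar + x0 * cstar - dot dvec (Mmx *m uxv x0 + bar pfst)).
Definition qvec : 'cV[R]_d :=
  Mmx *m uvec + ((bstar - dot dvec (Mmx *m uvec + bar pfst)) / dz) *: zvec.
Definition rvec : 'cV[R]_d :=
  Mmx *m vvec + ((cstar - dot dvec (Mmx *m vvec)) / dz) *: zvec.

Definition full_set (x0 : R) : set R :=
  [set delta | [/\ enorm (qvec + delta *: rvec) ^+ 2 = (hd pfst - delta) ^+ 2,
                   0 <= alpha_star delta, delta <= hd pstar & delta <= x0]]%classic.

Definition is_full (x0 : R) (xf : \bar R) : Prop :=
  is_max_or_ninfty (full_set x0) xf.

Definition rho (x0 : R) : 'cV[R]_(1 + s) :=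
  col_mx (1 - csum (uxv x0))%:M (uxv x0).
Definition sigma : 'cV[R]_(1 + s) := col_mx (-1 - csum wvec)%:M wvec.

Definition dependent_index (x0 : R) (k : 'I_s.+1) : Prop :=
  sigma k 0 < 0 /\
  forall i : 'I_s.+1, sigma i 0 < 0 ->
    - rho x0 k 0 / sigma k 0 <= - rho x0 i 0 / sigma i 0.

Definition curve_point (x0 : R) : V := mkpt x0 (Gamma_plus x0).

End Quantities.

Section Algorithm.
Variables (R : realType) (d : nat).
Local Notation V := 'cV[R]_(1 + d).
Implicit Types (x p : V) (S P : {fset V}).

Definition enumerates s (t : s.+1.-tuple V) S : Prop :=
  uniq t /\ (forall p, (p \in S) = (p \in tval t)).

Definition two_point_solution (p1 p : V) : V :=
  let x0 := Num.min (hd p1) (Num.min (hd p)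
              ((hd p1 + hd p - enorm (bar p1 - bar p)) / 2)) in
  mkpt x0 (((hd p1 - x0) + (hd p - x0))^-1 *:
             ((hd p1 - x0) *: bar p + (hd p - x0) *: bar p1)).

(* [Check S x]: about to perform the optimality check.                         *)
(* [Search p S x]: about to perform the curve search for the violated point p. *)
Inductive state :=
  | Check of {fset V} & V
  | Search of V & {fset V} & V.

Definition entering P S x p : Prop :=
  [/\ p \in P, ~~ soc_le x p & ~ (forall q, q \in S -> soc_le p q)].

(* All choices (violated point, enumeration of S, leaving point in case of a   *)
(* tie, optional two-point step) are left open.                                *)
(*   [step_exhausted] covers the situation where successive partial steps have *)
(* removed every point of S, for which the formulas of the curve search are    *)
(* void.  The curve then is {(x0; \bar p) | x0 : R}: no point can leave the    *)
(* empty set, and the constraint of p becomes tight at p itself, which is thus *)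
(* the result of the full step.                                                *)
Inductive step P : state -> state -> Prop :=
  | step_dominated S x p :
      p \in P -> ~~ soc_le x p -> (forall q, q \in S -> soc_le p q) ->
      step P (Check S x) (Check [fset p]%fset p)
  | step_two_points p1 x p :
      entering P [fset p1]%fset x p ->
      step P (Check [fset p1]%fset x)
             (Check [fset p1; p]%fset (two_point_solution p1 p))
  | step_independent S x p s (t : s.+1.-tuple V) :
      entering P S x p -> enumerates t S -> enorm (zvec t p) <> 0 ->
      step P (Check S x) (Search p S x)
  | step_dependent S x p s (t : s.+1.-tuple V) (k : 'I_s.+1) :
      entering P S x p -> enumerates t S -> enorm (zvec t p) = 0 ->
      dependent_index t p (hd x) k ->
      step P (Check S x) (Search p (S `\ tnth t k)%fset x)
  | step_partial S x p s (t : s.+1.-tuple V) (k : 'I_s.+1) xp xf :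
      enumerates t S ->
      is_partial t p (hd x) xp -> partial_set t p (hd x) k xp ->
      is_full t p (hd x) xf -> (xf <= xp%:E)%E ->
      step P (Search p S x) (Search p (S `\ tnth t k)%fset (curve_point t p xp))
  | step_full S x p s (t : s.+1.-tuple V) xp xf :
      enumerates t S ->
      is_partial t p (hd x) xp ->
      is_full t p (hd x) xf -> (xp%:E < xf)%E ->
      step P (Search p S x) (Check (p |` S)%fset (curve_point t p (fine xf)))
  | step_exhausted x p :
      step P (Search p fset0 x) (Check [fset p]%fset p).

Definition reachable P : state -> state -> Prop := clos_refl_trans state (step P).

Definition stops P (st : state) : Prop :=
  if st is Check _ x then Inf_feasible P x else False.

Definition correct_output P (st : state) : Prop :=
  if st is Check Sj x then Inf P x /\ optimal_support_set P Sj else False.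

(* Whatever the choices: there is no infinite run, a run is never blocked      *)
(* before the optimality check succeeds, and the output is correct.            *)
Definition solves_in_finitely_many_iterations P (start : state) : Prop :=
  [/\ ~ (exists run : nat -> state,
           run 0%N = start /\ forall i, step P (run i) (run i.+1)),
      forall st, reachable P start st -> ~ stops P st -> exists st', step P st st'
    & forall st, reachable P start st -> stops P st -> correct_output P st].

End Algorithm.

(* Main.v *)
Require Import Defs.
From mathcomp Require Import all_boot all_order all_algebra finmap.
From mathcomp Require Import boolp classical_sets cardinality reals constructive_ereal.
From mathcomp Require Import topology normedtype realfun.
From mathcomp Require Import ring lra zify.

Set Implicit Arguments.
Unset Strict Implicit.
Unset Printing Implicit Defensive.

Import Order.TTheory GRing.Theory Num.Theory.
Import numFieldNormedType.Exports.
Local Open Scope ring_scope.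

(** Why the algorithm terminates with the right answer.

    A point [x] with all constraints of [S] tight and [bar x] in the convex hull
    of the [bar q], [q \in S], is the unique solution of the problem for [S]: a
    feasible point at a level at least as high would be at least as close to all
    points of [S], while a barycentre minimises the mean square distance
    ([huygens], [level_bound]).  Hence the level [hd x] at an optimality check
    is determined by the current set, a subset of the finite [P].  The levels
    decrease strictly from one check to the next, and between two checks the
    current set shrinks; this gives a natural number that decreases along every
    run ([rank], [step_inv]).

    During a curve search for [p], the invariant [search_inv] says that the
    constraints of [S] are tight at [x], that [bar x] is a convex combination of
    [S] and [p], whose projections are affinely independent, and that [x] does
    not satisfy the constraint of [p] strictly.  Barycentric coordinates are
    determined by the level and the coefficient of [p] ([coords_unique]), so
    that such a state lies on the curve of its own set, also after a point has
    left it ([search_start]).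

    The delicate point is the square root in the curve: the set of levels where
    its argument is nonnegative need not be connected.  If the argument is
    nonpositive at a level [a] below [hd x] while the coordinates are all
    nonnegative, then the curve passes there through the convex hull of [S], at
    a distance from [S] that forbids any feasible point above [a] by
    [level_bound]; but [x] is feasible ([radicand_le0]).  Consequently the
    coordinates stay nonnegative, and the square root real, all the way from
    [hd x] down to the level of the partial step ([alpha_ge0_after]).  The
    partial step exists since otherwise the curve would remain in a bounded
    convex hull at levels tending to minus infinity ([partial_nonempty]).  The
    constraint of [p] is compared with those of [S] through the sign of
    [alpha_star - alpha_plus] ([cone_gap_pstar]), so that it cannot become
    strictly satisfied before the full step ([still_violated]).

    A partial and a full step of the same length make the constraint of [p]
    tight before the search ends, and the next check then takes place at the
    current level; for this reason the invariant asks for a weak violation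
    only, together with a positive coefficient of [p] when the violation is
    not strict. *)

(** * Euclidean geometry *)

Section Euclidean.
Variables (R : realType) (d : nat).
Implicit Types (x y w : 'cV[R]_d) (a : R).

Lemma dotE x y : dot x y = \sum_i x i 0 * y i 0.
Proof. by rewrite /dot mxE; apply: eq_bigr => i _; rewrite mxE. Qed.

Lemma dotC x y : dot x y = dot y x.
Proof. by rewrite !dotE; apply: eq_bigr => i _; rewrite mulrC. Qed.

Lemma dotDr x y w : dot x (y + w) = dot x y + dot x w.
Proof. by rewrite /dot mulmxDr mxE. Qed.

Lemma dotNr x y : dot x (- y) = - dot x y.
Proof. by rewrite /dot mulmxN mxE. Qed.

Lemma dotZr a x y : dot x (a *: y) = a * dot x y.
Proof. by rewrite /dot -scalemxAr mxE. Qed.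

Lemma dotDl x y w : dot (y + w) x = dot y x + dot w x.
Proof. by rewrite dotC dotDr ![dot x _]dotC. Qed.

Lemma dotNl x y : dot (- y) x = - dot y x.
Proof. by rewrite dotC dotNr dotC. Qed.

Lemma dotZl a x y : dot (a *: y) x = a * dot y x.
Proof. by rewrite dotC dotZr dotC. Qed.

Lemma dot0r x : dot x 0 = 0.
Proof. by rewrite /dot mulmx0 mxE. Qed.

Lemma dot_sumr (I : Type) (r : seq I) x (F : I -> 'cV[R]_d) :
  dot x (\sum_(i <- r) F i) = \sum_(i <- r) dot x (F i).
Proof. by elim/big_rec2: _ => [|i b c _ <-]; rewrite ?dot0r ?dotDr. Qed.

Definition dot_linear := (dotDl, dotDr, dotNl, dotNr, dotZl, dotZr).

Lemma dot_ge0 x : 0 <= dot x x.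
Proof. by rewrite dotE; apply: sumr_ge0 => i _; rewrite -expr2 sqr_ge0. Qed.

Lemma dot_eq0 x : (dot x x == 0) = (x == 0).
Proof.
apply/eqP/eqP => [|->]; last by rewrite dot0r.
rewrite dotE => /eqP; rewrite psumr_eq0; last first.
  by move=> i _; rewrite -expr2 sqr_ge0.
move/allP => h; apply/colP => i; rewrite mxE.
by have /(_ (mem_index_enum i)) := h i; rewrite /= mulf_eq0 orbb => /eqP.
Qed.

Lemma enorm_ge0 x : 0 <= enorm x.
Proof. exact: sqrtr_ge0. Qed.

Lemma enorm_sqr x : enorm x ^+ 2 = dot x x.
Proof. by rewrite sqr_sqrtr ?dot_ge0. Qed.

Lemma enorm_eq0 x : (enorm x == 0) = (x == 0).
Proof. by rewrite -dot_eq0 -enorm_sqr expf_eq0. Qed.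

Lemma enormB x y : enorm (x - y) = enorm (y - x).
Proof. by rewrite /enorm -opprB dotNl dotNr opprK. Qed.

Lemma enorm_eqP x a : 0 <= a -> dot x x = a ^+ 2 -> enorm x = a.
Proof. by move=> a0 xa; rewrite /enorm xa sqrtr_sqr ger0_norm. Qed.

Lemma enorm_le x a : 0 <= a -> (enorm x <= a) = (dot x x <= a ^+ 2).
Proof.
by move=> a0; rewrite -enorm_sqr ler_sqr ?nnegrE ?enorm_ge0.
Qed.

Lemma ge_enorm x a : a ^+ 2 <= dot x x -> a <= enorm x.
Proof.
move=> ax; have [a0|a0] := leP 0 a; last exact: le_trans (ltW a0) (enorm_ge0 x).
by rewrite -ler_sqr ?nnegrE ?enorm_ge0 // enorm_sqr.
Qed.

(** Huygens' identity: the mean square distance to an arbitrary point exceeds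
    the mean square distance to the barycentre by the square distance between
    the two.  All the optimality arguments rest on it, which spares a
    separation theorem. *)
Lemma huygens (I : Type) (r : seq I) (l : I -> R) (a : I -> 'cV[R]_d) c w :
  \sum_(i <- r) l i = 1 -> \sum_(i <- r) l i *: a i = c ->
  \sum_(i <- r) l i * dot (a i - w) (a i - w) =
  \sum_(i <- r) l i * dot (a i - c) (a i - c) + dot (c - w) (c - w).
Proof.
move=> l1 ac.
have expand v : \sum_(i <- r) l i * dot (a i - v) (a i - v) =
    \sum_(i <- r) l i * dot (a i) (a i) - 2 * dot v c + dot v v.
  have -> : dot v v = \sum_(i <- r) l i * dot v v by rewrite -mulr_suml l1 mul1r.
  rewrite -ac dot_sumr mulr_sumr -sumrB -big_split.
  by apply: eq_bigr => i _; rewrite /= !dot_linear [dot (a i) v]dotC; ring.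
by rewrite !expand !dot_linear [dot c w]dotC; ring.
Qed.

End Euclidean.

(** * Optimality certificates *)

Section Certificates.
Variables (R : realType) (d : nat).
Local Notation V := 'cV[R]_(1 + d).
Implicit Types (x y p q : V) (S T P : {fset V}) (l : V -> R) (c : 'cV[R]_d).

Lemma hd_mkpt (a : R) c : hd (mkpt a c) = a.
Proof.
rewrite /hd /mkpt (_ : 0 = lshift d 0 :> 'I_(1 + d)); last exact/val_inj.
by rewrite col_mxEu mxE.
Qed.

Lemma bar_mkpt (a : R) c : bar (mkpt a c) = c.
Proof. exact: col_mxKd. Qed.

Lemma eq_pt x y : hd x = hd y -> bar x = bar y -> x = y.
Proof.
move=> xy0 xyb; rewrite -[x]vsubmxK -[y]vsubmxK; congr col_mx; last exact: xyb.
apply/colP => i; rewrite ord1 !mxE.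
have -> : lshift d 0 = 0 :> 'I_(1 + d) by exact/val_inj.
exact: xy0.
Qed.

Lemma mkptK x : mkpt (hd x) (bar x) = x.
Proof. by apply: eq_pt; rewrite ?hd_mkpt ?bar_mkpt. Qed.

Lemma soc_leE x p : soc_le x p = (enorm (bar p - bar x) <= hd p - hd x).
Proof. by rewrite /soc_le /in_soc /bar linearB /hd !mxE. Qed.

Lemma soc_lexx x : soc_le x x.
Proof. by rewrite soc_leE !subrr /enorm dot0r sqrtr0. Qed.

Definition barycenter S l c : Prop :=
  \sum_(q <- S) l q = 1 /\ \sum_(q <- S) l q *: bar q = c.

Definition tight S x : Prop :=
  forall q, q \in S -> enorm (bar q - bar x) = hd q - hd x.

(** Affine independence of the family of the [bar q], [q \in S], which unlike
    that of the set [bars S] excludes repetitions. *)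
Definition independent S : Prop :=
  forall l, \sum_(q <- S) l q = 0 -> \sum_(q <- S) l q *: bar q = 0 ->
  forall q, q \in S -> l q = 0.

(** A dual feasible pair, the relative interior being replaced by the
    positivity of the barycentric coordinates. *)
Definition certified S x : Prop :=
  [/\ tight S x, independent S
    & exists2 l, forall q, q \in S -> 0 < l q & barycenter S l (bar x)].

Lemma tight_feasible S x : tight S x -> Inf_feasible S x.
Proof. by move=> tS q qS; rewrite soc_leE tS. Qed.

Lemma barycenter_in S l c : barycenter S l c -> exists q, q \in S.
Proof.
move=> [l1 _]; have [S0|//] := fset_0Vmem S.
  by move: l1; rewrite S0 big_nil => /esym/eqP; rewrite oner_eq0.
by case=> q qS; exists q.
Qed.

(** A point feasible at a higher level would be strictly closer than [c] to
    all points of [S], whereas by Huygens' identity a barycentre minimises the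
    mean square distance. *)
Lemma level_bound S l c a y :
  (forall q, q \in S -> 0 <= l q) -> barycenter S l c ->
  (forall q, q \in S -> hd q - a <= enorm (bar q - c)) ->
  Inf_feasible S y -> hd y <= a /\ (hd y = a -> bar y = c).
Proof.
move=> l_ge0 lc far yS; have [q0 q0S] := barycenter_in lc.
have near_c : a <= hd y -> bar y = c.
  move=> ay; apply/esym/eqP; rewrite -subr_eq0 -dot_eq0 eq_le dot_ge0 andbT.
  have : \sum_(q <- S) l q * dot (bar q - bar y) (bar q - bar y) <=
      \sum_(q <- S) l q * dot (bar q - c) (bar q - c).
    rewrite big_seq [leRHS]big_seq; apply: ler_sum => q qS.
    rewrite ler_wpM2l ?l_ge0 // -!enorm_sqr ler_sqr ?nnegrE ?enorm_ge0 //.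
    have := yS q qS; rewrite soc_leE => yq.
    by apply: le_trans (far q qS); apply: le_trans yq _; lra.
  by rewrite (huygens (bar y) lc.1 lc.2) gerDl.
split=> [|ya]; last by apply: near_c; rewrite ya.
rewrite leNgt; apply/negP => ay.
have := yS _ q0S; rewrite soc_leE near_c; last exact: ltW.
by have := far _ q0S; lra.
Qed.

Lemma tight_optimal S l x y :
  (forall q, q \in S -> 0 <= l q) -> barycenter S l (bar x) -> tight S x ->
  Inf_feasible S y -> hd y <= hd x /\ (hd y = hd x -> y = x).
Proof.
move=> l_ge0 lx tS yS.
have [q qS|yx eqyx] := level_bound (a := hd x) l_ge0 lx _ yS.
  by rewrite tS.
by split=> // yx0; apply: eq_pt; rewrite ?eqyx.
Qed.

Lemma certified_Inf S x : certified S x -> Inf S x.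
Proof.
case=> tS _ [l l_gt0 lx]; split=> [|y yS]; first exact: tight_feasible.
by have [] := tight_optimal (fun q qS => ltW (l_gt0 q qS)) lx tS yS.
Qed.

Lemma certified_optimal S x y : certified S x -> Inf_feasible S y ->
  hd y <= hd x /\ (hd y = hd x -> y = x).
Proof.
by case=> tS _ [l l_gt0 lx]; apply: tight_optimal lx tS => q /l_gt0/ltW.
Qed.

Lemma independent_fset1 p : independent [fset p]%fset.
Proof. by move=> l; rewrite big_seq_fset1 => lp _ q /fset1P ->. Qed.

Lemma certified_fset1 p : certified [fset p]%fset p.
Proof.
split; [|exact: independent_fset1|].
- by move=> q /fset1P ->; rewrite !subrr /enorm dot0r sqrtr0.
- exists (fun=> 1) => [_ _|]; first exact: ltr01.
  by split; rewrite !big_seq_fset1 ?scale1r.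
Qed.

Lemma sub_independent S T : (T `<=` S)%fset -> independent S -> independent T.
Proof.
move=> /fsubsetP TS indS l l0 lb q qT.
have restrict (W : lmodType R) (F : V -> W) :
    \sum_(i <- S) (if i \in T then F i else 0) = \sum_(i <- T) F i.
  rewrite -big_mkcond [LHS](big_fset_condE) /=; apply: eq_fbigl => i.
  by rewrite !inE /= andbC; case: (boolP (i \in T)) => //= /TS ->.
pose l' i := if i \in T then l i else 0.
have := indS l' _ _ q (TS _ qT); rewrite /l' qT; apply.
  by rewrite (restrict R^o).
rewrite -[RHS]lb -restrict; apply: eq_bigr => i _.
by case: ifP => _; rewrite ?scale0r.
Qed.

Lemma barycenterU1 S p l (c : 'cV[R]_d) : p \notin S ->
  barycenter (p |` S)%fset l c <->
  l p + \sum_(q <- S) l q = 1 /\ l p *: bar p + \sum_(q <- S) l q *: bar q = c.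
Proof. by move=> pS; rewrite /barycenter !big_fsetU1. Qed.

Lemma barycenterD1 S p k l (c : 'cV[R]_d) : p \notin S -> k \in S -> l k = 0 ->
  barycenter (p |` S)%fset l c -> barycenter (p |` (S `\ k))%fset l c.
Proof.
move=> pS kS lk /(barycenterU1 _ _ pS); rewrite !(big_fsetD1 _ kS) /= lk.
rewrite scale0r !add0r => lc; apply/barycenterU1 => //.
by rewrite in_fsetD1 negb_and pS orbT.
Qed.

End Certificates.

(** * The curve in barycentric coordinates *)

Section Curve.
Variables (R : realType) (d s : nat).
Local Notation V := 'cV[R]_(1 + d).
Variables (t : s.+1.-tuple V) (p : V).
Implicit Types (S : {fset V}) (a b : R) (i : 'I_s.+1) (m : 'cV[R]_s).

Definition coords a b : 'cV[R]_(1 + s) := rho t a + b *: sigma t p.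

(** When the points of [t] are affinely independent, these are the points of the
    affine span of [t] and [p] at which the cone equations of all points of [t]
    at level [a] have the same residual; [b] is the coefficient of [p], and
    [alpha_plus] its nonnegative value for which the residual vanishes. *)
Definition curve a b : 'cV[R]_d :=
  Mmx t *m uxv t a + b *: zvec t p + bar (pfst t).

Lemma alphaE a : alpha t p a = coords a (alpha_plus t p a).
Proof.
rewrite /alpha /coords /rho /sigma scale_col_mx add_col_mx; congr col_mx.
by apply/colP => i; rewrite !mxE !ord1 !eqxx !mulr1n; ring.
Qed.

Lemma Gamma_plusE a : Gamma_plus t p a = curve a (alpha_plus t p a).
Proof. by []. Qed.

Lemma col_mx_ord0 (e : R) m : col_mx e%:M m (ord0 : 'I_s.+1) 0 = e.
Proof.
rewrite (_ : ord0 = lshift s ord0 :> 'I_(1 + s)); last exact/val_inj.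
by rewrite (col_mxEu e%:M m) mxE.
Qed.

Lemma col_mx_lift (e : R) m (i : 'I_s) :
  col_mx e%:M m (lift ord0 i : 'I_s.+1) 0 = m i 0.
Proof.
rewrite (_ : lift ord0 i = rshift 1 i :> 'I_(1 + s)); last exact/val_inj.
by rewrite (col_mxEd e%:M m).
Qed.

Lemma coords_ord0 a b :
  coords a b (ord0 : 'I_s.+1) 0 = 1 - csum (uxv t a) + b * (- 1 - csum (wvec t p)).
Proof.
by rewrite /coords mxE [X in _ + X]mxE /rho /sigma !col_mx_ord0.
Qed.

Lemma coords_lift a b (i : 'I_s) :
  coords a b (lift ord0 i : 'I_s.+1) 0 = uxv t a i 0 + b * wvec t p i 0.
Proof.
by rewrite /coords mxE [X in _ + X]mxE /rho /sigma !col_mx_lift.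
Qed.

Lemma MmxE m : Mmx t *m m = \sum_i m i 0 *: (bar (pnext t i) - bar (pfst t)).
Proof.
apply/colP => j; rewrite mxE summxE; apply: eq_bigr => i _.
by rewrite !mxE mulrC.
Qed.

Lemma zvecE : zvec t p = dvec t p + Mmx t *m wvec t p.
Proof. by rewrite /zvec /wvec mulmxBl mul1mx mulmxN -mulmxA. Qed.

Lemma sum_coords a b : \sum_(i < s.+1) coords a b i 0 + b = 1.
Proof.
rewrite big_ord_recl coords_ord0; under eq_bigr do rewrite coords_lift.
by rewrite big_split /= -mulr_sumr /csum; ring.
Qed.

Lemma csumDZ (x y : 'cV[R]_s) a : csum (x + a *: y) = csum x + a * csum y.
Proof.
rewrite /csum mulr_sumr -big_split; apply: eq_bigr => i _.
by rewrite mxE [X in _ + X]mxE.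
Qed.

Lemma comb_fst c b :
  (1 - b - csum c) *: bar (pfst t) + \sum_(i < s) c i 0 *: bar (pnext t i) +
  b *: bar p = Mmx t *m c + b *: dvec t p + bar (pfst t).
Proof.
rewrite MmxE; under [in RHS]eq_bigr do rewrite scalerBr.
rewrite sumrB -scaler_suml /dvec /csum !scalerBl scale1r scalerBr.
apply/colP => j; rewrite !mxE; ring.
Qed.

Lemma curve_comb a b :
  \sum_(i < s.+1) coords a b i 0 *: bar (pt t i) + b *: bar p = curve a b.
Proof.
pose c := uxv t a + b *: wvec t p.
have -> : curve a b = Mmx t *m c + b *: dvec t p + bar (pfst t).
  by rewrite /curve zvecE scalerDr scalemxAr addrA addrAC -mulmxDr addrAC.
have cE (i : 'I_s) : coords a b (lift ord0 i : 'I_s.+1) 0 = c i 0.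
  by rewrite coords_lift /c [RHS]mxE [X in _ = _ + X]mxE.
have c0 : coords a b (ord0 : 'I_s.+1) 0 = 1 - b - csum c.
  have := sum_coords a b; rewrite big_ord_recl; under eq_bigr do rewrite cE.
  by rewrite /csum => <-; ring.
by rewrite -comb_fst big_ord_recl; under eq_bigr do rewrite cE; rewrite c0.
Qed.

End Curve.

(** * Cone equations along the curve *)

Section CurveGeometry.
Variables (R : realType) (d s : nat).
Local Notation V := 'cV[R]_(1 + d).
Variables (t : s.+1.-tuple V) (p : V).
Implicit Types (q : V) (a b : R) (i : 'I_s.+1) (m : 'cV[R]_s) (y : 'cV[R]_d).

(** The point [(a; y)] is on the boundary of the double cone of apex [q]
    exactly when this vanishes. *)
Definition cone_gap q a y : R := dot (bar q - y) (bar q - y) - (hd q - a) ^+ 2.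

Lemma cone_gap_eq0 q a y : a <= hd q ->
  (cone_gap q a y == 0) = (enorm (bar q - y) == hd q - a).
Proof.
move=> aq; rewrite /cone_gap subr_eq0 -enorm_sqr eqrXn2 ?enorm_ge0 //.
by rewrite subr_ge0.
Qed.

(** Differences of two cone equations are affine in [(a; y)]. *)
Lemma cone_gapB q a y : cone_gap q a y - cone_gap (pfst t) a y =
  2 * (half_gap t q + a * (hd q - hd (pfst t)) - dot (bar q - bar (pfst t)) y).
Proof.
rewrite /cone_gap /half_gap !enorm_sqr !dot_linear ![dot y (bar _)]dotC.
by field.
Qed.

Lemma trMmxE y (i : 'I_s) :
  ((Mmx t)^T *m y) i 0 = dot (bar (pnext t i) - bar (pfst t)) y.
Proof. by rewrite mxE dotE; apply: eq_bigr => j _; rewrite !mxE. Qed.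

Hypothesis Mmx_inj : forall m, Mmx t *m m = 0 -> m = 0.

Lemma Gram_unit : (Mmx t)^T *m Mmx t \in unitmx.
Proof.
rewrite -row_free_unit; apply: inj_row_free => v vG.
rewrite -[v]trmxK [v^T]Mmx_inj ?trmx0 //; apply/eqP.
rewrite -dot_eq0 /dot trmx_mul trmxK -mulmxA (mulmxA _ (Mmx t)) mulmxA vG mul0mx.
by rewrite mxE.
Qed.

Lemma trMmx_z : (Mmx t)^T *m zvec t p = 0.
Proof.
have proj : (Mmx t)^T *m (Mmx t *m Mplus t) = (Mmx t)^T.
  by rewrite /Mplus /Gram_inv !mulmxA mulmxV ?Gram_unit // mul1mx.
by rewrite /zvec mulmxBl mul1mx mulmxBr mulmxA proj subrr.
Qed.

Lemma dot_Mmx_z m : dot (Mmx t *m m) (zvec t p) = 0.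
Proof. by rewrite /dot trmx_mul -mulmxA trMmx_z mulmx0 mxE. Qed.

Lemma dzE : dz t p = dot (zvec t p) (zvec t p).
Proof.
rewrite /dz; have -> : dvec t p = zvec t p - Mmx t *m wvec t p.
  by rewrite zvecE addrK.
by rewrite dotDl dotNl dot_Mmx_z subr0.
Qed.

Lemma Gram_uxv a : ((Mmx t)^T *m Mmx t) *m uxv t a =
  bvec t + a *: cvec t - (Mmx t)^T *m bar (pfst t).
Proof.
rewrite /uxv mulmxDr -scalemxAr /uvec /vvec /Gram_inv.
by rewrite !mulKVmx ?Gram_unit // addrAC.
Qed.

Lemma trMmx_curve a b : (Mmx t)^T *m curve t p a b = bvec t + a *: cvec t.
Proof.
rewrite /curve 2!mulmxDr -(scalemxAr b) trMmx_z scaler0 addr0 (mulmxA _ (Mmx t)).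
by rewrite Gram_uxv subrK.
Qed.

Lemma cone_gap_curve a b i : cone_gap (pt t i) a (curve t p a b) =
  b ^+ 2 * dot (zvec t p) (zvec t p) - radicand t a.
Proof.
have fst_gap : cone_gap (pfst t) a (curve t p a b) =
    b ^+ 2 * dot (zvec t p) (zvec t p) - radicand t a.
  rewrite /cone_gap /curve /radicand enorm_sqr opprD addrCA subrr addr0.
  by rewrite !dot_linear [dot (zvec t p) (Mmx t *m _)]dotC dot_Mmx_z; ring.
case: (unliftP ord0 i) => [i' ->|->] //.
have : cone_gap (pnext t i') a (curve t p a b) -
       cone_gap (pfst t) a (curve t p a b) = 0.
  rewrite cone_gapB -trMmxE trMmx_curve.
  by rewrite !mxE; ring.
by move/eqP; rewrite subr_eq0 => /eqP ->.
Qed.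

Lemma cone_gap_curve_pstar a b : zvec t p != 0 ->
  cone_gap p a (curve t p a b) = cone_gap (pfst t) a (curve t p a b) +
    2 * dz t p * (alpha_star t p a - b).
Proof.
move=> z0; have dz0 : dz t p != 0 by rewrite dzE dot_eq0.
apply/eqP; rewrite addrC -subr_eq cone_gapB /alpha_star /curve.
rewrite -/(dvec t p) -/(cstar t p) -/(bstar t p) !dotDr !dotZr -/(dz t p).
by apply/eqP; field.
Qed.

(** Equating the cone equations of the points of [t] leaves a linear system for
    the barycentric coordinates, with invertible Gram matrix: the coordinates
    are determined by the level and by the coefficient of [p]. *)
Lemma coords_unique (l : 'I_s.+1 -> R) a b y :
  \sum_i l i + b = 1 -> \sum_i l i *: bar (pt t i) + b *: bar p = y ->
  (forall i, cone_gap (pt t i) a y = 0) ->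
  (forall i, l i = coords t p a b i 0) /\ y = curve t p a b.
Proof.
move=> l1 ly gap0.
pose m : 'cV[R]_s := \col_i l (lift ord0 i).
have mE (i : 'I_s) : l (lift ord0 i) = m i 0 by rewrite mxE.
have l0 : l ord0 = 1 - b - csum m.
  move: l1; rewrite big_ord_recl; under eq_bigr do rewrite mE.
  by rewrite /csum => <-; ring.
have ym : y = Mmx t *m (m - b *: wvec t p) + b *: zvec t p + bar (pfst t).
  rewrite -ly big_ord_recl l0; under eq_bigr do rewrite mE.
  rewrite comb_fst zvecE mulmxBr -scalemxAr (scalerDr b (dvec t p)).
  by rewrite [b *: dvec t p + b *: (_ *m _)]addrC addrA subrK.
have mu : m - b *: wvec t p = uxv t a.
  apply: (can_inj (mulKmx Gram_unit)); rewrite Gram_uxv.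
  have <- : (Mmx t)^T *m y = bvec t + a *: cvec t.
    apply/colP => i; rewrite trMmxE !mxE.
    have := cone_gapB (pnext t i) a y; rewrite /pnext /pfst !gap0 subr0.
    by move/esym/eqP; rewrite mulf_eq0 pnatr_eq0 /= subr_eq0 => /eqP ->.
  rewrite ym 2!mulmxDr -(scalemxAr b) trMmx_z scaler0 addr0.
  by rewrite (mulmxA _ (Mmx t)) addrK.
split; last by rewrite ym mu.
move=> i; case: (unliftP ord0 i) => [i' ->|->].
  by rewrite coords_lift mE -mu !mxE subrK.
by rewrite coords_ord0 l0 -mu -scaleNr csumDZ; ring.
Qed.

End CurveGeometry.

(** * Enumerated support sets *)

Section Enumeration.
Variables (R : realType) (d : nat).
Local Notation V := 'cV[R]_(1 + d).
Implicit Types (S : {fset V}) (p q k : V).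

Lemma enumerates_exists S k : k \in S ->
  exists s (t : s.+1.-tuple V), enumerates t S /\ pfst t = k.
Proof.
move=> kS.
have size_t : size (k :: enum_fset (S `\ k)%fset) == #|` (S `\ k)%fset|.+1 by [].
exists #|` (S `\ k)%fset|, (Tuple size_t); split; last by [].
split=> [|q] /=; first by rewrite fset_uniq andbT !inE eqxx.
by rewrite inE !inE; case: eqP => [->|] //=; rewrite andbT.
Qed.

Variables (s : nat) (t : s.+1.-tuple V) (S : {fset V}).
Hypothesis tS : enumerates t S.
Implicit Type i : 'I_s.+1.

Lemma pt_in i : pt t i \in S.
Proof. by rewrite tS.2 mem_tnth. Qed.

Lemma pt_onto q : q \in S -> exists i, q = pt t i.
Proof. by rewrite tS.2 => /tnthP. Qed.

Lemma big_pt (W : nmodType) (F : V -> W) :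
  \sum_(q <- S) F q = \sum_i F (pt t i).
Proof.
rewrite -(big_tuple _ _ _ xpredT F); apply: perm_big.
by apply: uniq_perm; rewrite ?fset_uniq ?tS.1 // => q; rewrite tS.2.
Qed.

Lemma weights_of (l : 'I_s.+1 -> R) : exists l', forall i, l' (pt t i) = l i.
Proof.
exists (fun q => l (inord (index q t))) => i; congr l; apply: val_inj.
rewrite /= inordK; first by rewrite /pt (tnth_nth 0) index_uniq ?size_tuple ?tS.1.
by rewrite -[X in (_ < X)%N](size_tuple t) index_mem mem_tnth.
Qed.

Lemma Mmx_inj_independent : independent S ->
  forall m : 'cV_s, Mmx t *m m = 0 -> m = 0.
Proof.
move=> indS m Mm0.
pose l i : R := if unlift ord0 i is Some i' then m i' 0 else - csum m.
have l_ord0 : l ord0 = - csum m by rewrite /l unlift_none.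
have l_lift (i' : 'I_s) : l (lift ord0 i') = m i' 0 by rewrite /l liftK.
have [l' l'E] := weights_of l.
have l'_lift (i' : 'I_s) : l' (pt t (lift ord0 i')) = m i' 0 by rewrite l'E l_lift.
apply/colP => i; rewrite -l'_lift mxE; apply: indS (pt_in _).
  rewrite big_pt big_ord_recl; under eq_bigr do rewrite l'_lift.
  by rewrite l'E l_ord0 addNr.
rewrite big_pt big_ord_recl; under eq_bigr do rewrite l'_lift.
rewrite l'E l_ord0; have := comb_fst t (pfst t) m 0.
rewrite Mm0 !scale0r !addr0 add0r subr0 scalerBl scale1r.
by move=> comb; apply: (addrI (bar (pfst t))); rewrite addr0 scaleNr addrA.
Qed.

Lemma sigma_sum p : \sum_i sigma t p i 0 = - 1.
Proof.
have := sum_coords t p 0 1; have := sum_coords t p 0 0.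
rewrite /coords addr0 scale0r addr0 scale1r => s0.
by under eq_bigr do rewrite mxE; rewrite big_split /= s0; lra.
Qed.

Lemma sigma_comb p : \sum_i sigma t p i 0 *: bar (pt t i) + bar p = zvec t p.
Proof.
have := curve_comb t p 0 1; have := curve_comb t p 0 0.
rewrite /curve /coords !scale0r !addr0 !scale1r => s0.
under eq_bigr do rewrite mxE scalerDl.
rewrite big_split /= s0 => s1.
apply: (addrI (Mmx t *m uxv t 0 + bar (pfst t))).
by rewrite addrA s1 addrAC.
Qed.

(** If [zvec] vanishes, [sigma] is an affine dependency with coefficient 1 at
    [p]. *)
Lemma zvec_neq0 p : p \notin S -> independent (p |` S)%fset -> zvec t p != 0.
Proof.
move=> pS ind; apply/eqP => z0.
have [l lE] := weights_of (fun i => sigma t p i 0).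
pose l' q := if q == p then 1 else l q.
have l'E i : l' (pt t i) = sigma t p i 0.
  rewrite /l' lE; case: eqP => // ptp.
  by move: pS; rewrite -ptp pt_in.
have l'p : l' p = 1 by rewrite /l' eqxx.
have l'0 : \sum_(q <- (p |` S)%fset) l' q = 0.
  rewrite big_fsetU1 //= big_pt; under eq_bigr do rewrite l'E.
  by rewrite l'p sigma_sum subrr.
have l'bar : \sum_(q <- (p |` S)%fset) l' q *: bar q = 0.
  rewrite big_fsetU1 //= big_pt; under eq_bigr do rewrite l'E.
  by rewrite l'p scale1r addrC sigma_comb.
have /eqP := ind l' l'0 l'bar p (fset1U1 _ _).
by rewrite l'p oner_eq0.
Qed.

Lemma dot_pt_z p i : independent S ->
  dot (bar (pt t i)) (zvec t p) = dot (bar (pfst t)) (zvec t p).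
Proof.
move=> /Mmx_inj_independent Minj; case: (unliftP ord0 i) => [i' ->|->] //.
apply/eqP; rewrite -subr_eq0 -dotNl -dotDl -trMmxE.
by rewrite trMmx_z // mxE.
Qed.

(** All points of [S] have the same inner product with [zvec], so that pairing
    an affine dependency with [zvec] isolates the coefficient of [p]. *)
Lemma zvec_independent p : independent S -> zvec t p != 0 ->
  p \notin S /\ independent (p |` S)%fset.
Proof.
move=> indS z0; have Minj := Mmx_inj_independent indS.
have dz_neq0 : dot (dvec t p) (zvec t p) != 0.
  by rewrite -/(dz t p) dzE // dot_eq0.
have pS : p \notin S.
  apply/negP => /pt_onto[i pi]; move: dz_neq0.
  by rewrite /dvec dotDl dotNl {1}pi dot_pt_z // subrr eqxx.
split=> // l; rewrite !big_fsetU1 //= => l0 lb.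
have lp0 : l p = 0.
  apply/eqP; move/(congr1 (dot (zvec t p))): lb.
  rewrite dotDr dot0r dotZr dot_sumr big_pt.
  under eq_bigr do rewrite dotZr dotC dot_pt_z //.
  rewrite -mulr_suml -(big_pt l) => /eqP.
  rewrite (_ : \sum_(q <- S) l q = - l p); last first.
    by apply/eqP; rewrite -addr_eq0 addrC l0.
  rewrite mulNr -mulrBr [dot (zvec _ _) _]dotC -dotNl -dotDl mulf_eq0.
  by rewrite (negPf dz_neq0) orbF.
move: l0 lb; rewrite lp0 scale0r !add0r => l0 lb q.
by rewrite !inE => /orP[/eqP -> //|]; apply: indS.
Qed.

Lemma weights_curve p (a b : R) : p \notin S -> exists l, [/\ l p = b,
  forall i, l (pt t i) = coords t p a b i 0 &
  barycenter (p |` S)%fset l (curve t p a b)].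
Proof.
move=> pS; have [l lE] := weights_of (fun i => coords t p a b i 0).
pose l' q := if q == p then b else l q.
have l'p : l' p = b by rewrite /l' eqxx.
have l'E i : l' (pt t i) = coords t p a b i 0.
  by rewrite /l' -lE; case: eqP => // ptp; move: pS; rewrite -ptp pt_in.
exists l'; split=> //; apply/barycenterU1 => //.
rewrite !big_pt l'p; under eq_bigr do rewrite l'E.
under [in X in _ /\ X]eq_bigr do rewrite l'E.
by rewrite addrC sum_coords addrC curve_comb.
Qed.

End Enumeration.

(** * Zeros of continuous functions *)

Section Continuity.
Variable R : realType.
Implicit Types (a b c : R) (f g : R -> R).

Lemma closed_has_max (A : set R) b :
  closed A -> (A !=set0)%classic -> (forall a, A a -> a <= b) ->
  exists m, is_max A m.
Proof.
move=> clA A0 Ab; have ubA : has_ubound A by exists b.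
exists (sup A); split=> [|a Aa]; last exact: ub_le_sup.
by have := closure_sup A0 ubA; rewrite -(closure_id A).1.
Qed.

Lemma closed_exists (I : finType) (F : I -> set R) :
  (forall i, closed (F i)) -> closed [set c | exists i, F i c]%classic.
Proof.
move=> clF; rewrite (_ : [set c | _]%classic = (\bigcup_(i in setT) F i)%classic).
  by apply: closed_bigcup => [|i _]; [exact: finite_finset|exact: clF].
by apply/seteqP; split=> c [i]; [exists i|move=> _ Fic; exists i].
Qed.

Lemma closed_le_zero f : continuous f -> closed [set a | f a <= 0]%classic.
Proof. by move=> /continuous_closedP/(_ _ (@closed_le _ 0)). Qed.

Lemma closed_ge_zero f : continuous f -> closed [set a | 0 <= f a]%classic.
Proof. by move=> /continuous_closedP/(_ _ (@closed_ge _ 0)). Qed.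

Lemma closed_zero f : continuous f -> closed [set a | f a = 0]%classic.
Proof. by move=> /continuous_closedP/(_ _ (@closed_eq _ 0)). Qed.

Lemma IVT_zero f a b : continuous f -> a <= b -> f a <= 0 -> 0 <= f b ->
  exists2 c, a <= c <= b & f c = 0.
Proof.
move=> cf ab fa fb; have [||c] := @IVT R f a b 0 ab.
- exact: continuous_subspaceT.
- by rewrite ge_min fa le_max fb orbT.
- by rewrite in_itv; exists c.
Qed.

(** Walking down from [b], a finite family of continuous functions stays
    nonnegative until one of its members vanishes. *)
Lemma last_zero (I : finType) (f : I -> R -> R) a b k :
  (forall i, continuous (f i)) -> a <= b -> (forall i, 0 <= f i b) ->
  f k a < 0 ->
  exists c, [/\ a <= c <= b, forall i, 0 <= f i c & exists i, f i c = 0].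
Proof.
move=> cf ab fb fka.
pose Z := [set c | exists i, [/\ f i c <= 0, a <= c & c <= b]]%classic.
have clZ : closed Z.
  apply: closed_exists => i.
  rewrite [X in closed X](_ : _ =
    ([set c | (f i c <= 0)%R] `&`
     ([set c | (a <= c)%R] `&` [set c | (c <= b)%R]))%classic).
    apply: closedI; first exact: closed_le_zero.
    by apply: closedI; [exact: closed_ge|exact: closed_le].
  by apply/seteqP; split=> c /= => [[? ? ?]|[? [? ?]]]; do !split.
have [|c [j []] //|c [[j [fjc ac cb]] c_max]] := closed_has_max (b := b) clZ.
  by exists a, k; rewrite ab lexx (ltW fka).
have f_ge0 i : 0 <= f i c.
  rewrite leNgt; apply/negP => fic.
  have [e /andP[ce eb] fie] := IVT_zero (cf i) cb (ltW fic) (fb i).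
  have /c_max ec : Z e by exists i; rewrite fie lexx (le_trans ac ce) eb.
  have eqec : e = c by apply: le_anti; rewrite ec ce.
  by move: fic; rewrite -eqec fie ltxx.
exists c; split=> //; first by rewrite ac cb.
by exists j; apply: le_anti; rewrite fjc f_ge0.
Qed.

End Continuity.

(** * Continuity along the curve *)

Section CurveContinuity.
Variables (R : realType) (d s : nat).
Variables (t : s.+1.-tuple 'cV[R]_(1 + d)) (p : 'cV[R]_(1 + d)).

Lemma radicandE : exists A B C, forall a, radicand t a = A + B * a + C * a ^+ 2.
Proof.
pose f := Mmx t *m uvec t; pose g := Mmx t *m vvec t; pose h := hd (pfst t).
exists (h ^+ 2 - dot f f), (- 2 * h - 2 * dot f g), (1 - dot g g) => a.
rewrite /radicand enorm_sqr /uxv mulmxDr -scalemxAr -/f -/g -/h.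
by rewrite !dot_linear [dot g f]dotC; ring.
Qed.

Lemma alpha_starE : exists A B, forall a, alpha_star t p a = A + B * a.
Proof.
pose c := dot (dvec t p) (Mmx t *m vvec t).
pose e := dot (dvec t p) (Mmx t *m uvec t) + dot (dvec t p) (bar (pfst t)).
exists ((dz t p)^-1 * (bstar t p - e)), ((dz t p)^-1 * (cstar t p - c)) => a.
rewrite /alpha_star /uxv mulmxDr -scalemxAr !dotDr dotZr -/c /e; ring.
Qed.

Lemma coordsE (i : 'I_s.+1) : exists A B C, forall a b,
  coords t p a b i 0 = A + B * a + C * b.
Proof.
have uxvE a i' : uxv t a i' 0 = uvec t i' 0 + a * vvec t i' 0.
  by rewrite /uxv mxE [X in _ + X]mxE.
case: (unliftP ord0 i) => [i' ->|->].
  exists (uvec t i' 0), (vvec t i' 0), (wvec t p i' 0) => a b.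
  by rewrite coords_lift uxvE; ring.
exists (1 - csum (uvec t)), (- csum (vvec t)), (- 1 - csum (wvec t p)) => a b.
by rewrite coords_ord0 /uxv csumDZ; ring.
Qed.

Lemma continuous_quadratic (A B C : R) :
  continuous (fun a => A + B * a + C * a ^+ 2).
Proof.
move=> a; apply: cvgD; first apply: cvgD; first exact: cvg_cst.
  by apply: cvgM; [exact: cvg_cst|exact: cvg_id].
apply: cvgM; first exact: cvg_cst.
by apply: cvgM; exact: cvg_id.
Qed.

Lemma radicand_continuous : continuous (radicand t).
Proof.
have [A [B [C E]]] := radicandE.
by rewrite (_ : radicand t = fun a => A + B * a + C * a ^+ 2);
  [exact: continuous_quadratic|exact/funext].
Qed.

Lemma alpha_plus_continuous : continuous (alpha_plus t p).
Proof.
move=> a; apply: cvgM; first exact: cvg_cst.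
by apply: continuous_comp; [exact: radicand_continuous|exact: sqrt_continuous].
Qed.

Lemma alpha_continuous (i : 'I_s.+1) : continuous (fun a => alpha t p a i 0).
Proof.
have [A [B [C E]]] := coordsE i.
rewrite (_ : (fun a => _) = fun a => A + B * a + C * alpha_plus t p a); last first.
  by apply/funext => a; rewrite alphaE E.
move=> a; apply: cvgD; first apply: cvgD; first exact: cvg_cst.
  by apply: cvgM; [exact: cvg_cst|exact: cvg_id].
by apply: cvgM; [exact: cvg_cst|exact: alpha_plus_continuous].
Qed.

Lemma alpha_star_continuous : continuous (alpha_star t p).
Proof.
have [A [B E]] := alpha_starE.
rewrite (_ : alpha_star t p = fun a => A + B * a); last exact/funext.
move=> a; apply: cvgD; first exact: cvg_cst.
by apply: cvgM; [exact: cvg_cst|exact: cvg_id].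
Qed.

End CurveContinuity.

(** * The curve search *)

Section Search.
Variables (R : realType) (d : nat).
Local Notation V := 'cV[R]_(1 + d).
Implicit Types (S : {fset V}) (p q x : V).

(** The violation of the constraint of [p] is weak, since a partial step may end
    exactly where this constraint becomes tight.  The last clause excludes that
    [x] be the solution of the problem for [S] with [p] tight as well: the
    coefficient of [p] in the certificate of the next check would be zero. *)
Definition search_inv S p x : Prop :=
  [/\ p \notin S, independent (p |` S)%fset, tight S x,
      hd p - hd x <= enorm (bar p - bar x)
    & exists l, [/\ forall q, q \in (p |` S)%fset -> 0 <= l q,
        barycenter (p |` S)%fset l (bar x) & 0 < l p \/ ~~ soc_le x p]].

Variables (s : nat) (t : s.+1.-tuple V) (S : {fset V}) (p x : V).
Hypothesis tS : enumerates t S.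
Hypothesis inv : search_inv S p x.
Implicit Types (a c xp : R) (i k : 'I_s.+1).

Let pS : p \notin S. Proof. by case: inv. Qed.
Let ind : independent (p |` S)%fset. Proof. by case: inv. Qed.
Let tightS : tight S x. Proof. by case: inv. Qed.
Let Minj : forall m : 'cV_s, Mmx t *m m = 0 -> m = 0.
Proof. exact: Mmx_inj_independent tS (sub_independent (fsubsetU1 _ _) ind). Qed.
Let z0 : zvec t p != 0. Proof. exact: zvec_neq0 tS _ pS ind. Qed.

Let zz_gt0 : 0 < dot (zvec t p) (zvec t p).
Proof. by rewrite lt_def dot_ge0 dot_eq0 z0. Qed.

Lemma hd_le q : q \in S -> hd x <= hd q.
Proof. by move=> /tightS qx; rewrite -subr_ge0 -qx enorm_ge0. Qed.

Lemma alpha_plus_ge0 a : 0 <= alpha_plus t p a.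
Proof. by rewrite mulr_ge0 ?invr_ge0 ?enorm_ge0 ?sqrtr_ge0. Qed.

Lemma alpha_plus_sqr a : 0 <= radicand t a ->
  alpha_plus t p a ^+ 2 * dot (zvec t p) (zvec t p) = radicand t a.
Proof.
move=> rad; rewrite /alpha_plus exprMn exprVn enorm_sqr sqr_sqrtr //.
by rewrite mulrAC mulVf ?mul1r ?gt_eqF.
Qed.

Lemma alpha_plus_unique a b : 0 <= b ->
  b ^+ 2 * dot (zvec t p) (zvec t p) = radicand t a ->
  0 <= radicand t a /\ b = alpha_plus t p a.
Proof.
move=> b0 ba; have rad : 0 <= radicand t a by rewrite -ba mulr_ge0 ?sqr_ge0 ?dot_ge0.
split=> //; apply/eqP; rewrite -(@eqrXn2 _ 2) ?alpha_plus_ge0 //.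
by rewrite -(inj_eq (mulIf (lt0r_neq0 zz_gt0))) alpha_plus_sqr // ba.
Qed.

Lemma alpha_plus_eq0 a : (alpha_plus t p a == 0) = (radicand t a <= 0).
Proof.
by rewrite mulf_eq0 invr_eq0 enorm_eq0 (negPf z0) sqrtr_eq0.
Qed.

Lemma curve_weights a : exists l, [/\ l p = alpha_plus t p a,
  forall i, l (pt t i) = alpha t p a i 0 &
  barycenter (p |` S)%fset l (Gamma_plus t p a)].
Proof.
have [l [lp lE lG]] := weights_curve tS a (alpha_plus t p a) pS.
by exists l; split=> // i; rewrite alphaE.
Qed.

Lemma cone_gap_pt a i : 0 <= radicand t a ->
  cone_gap (pt t i) a (Gamma_plus t p a) = 0.
Proof.
by move=> rad; rewrite Gamma_plusE cone_gap_curve // alpha_plus_sqr // subrr.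
Qed.

Lemma curve_tight a : a <= hd x -> 0 <= radicand t a -> tight S (curve_point t p a).
Proof.
move=> ax rad q qS; rewrite hd_mkpt bar_mkpt.
have aq := le_trans ax (hd_le qS); have [i qi] := pt_onto tS qS.
by apply/eqP; rewrite -cone_gap_eq0 // qi cone_gap_pt.
Qed.

(** The state lies on its own curve: this is the uniqueness of the
    barycentric coordinates. *)
Lemma search_start : [/\ 0 <= radicand t (hd x), curve_point t p (hd x) = x,
  forall i, 0 <= alpha t p (hd x) i 0 & 0 < alpha_plus t p (hd x) \/ ~~ soc_le x p].
Proof.
case: inv => _ _ _ _ [l [l_ge0 /(barycenterU1 _ _ pS)[l1 lx] lp]].
have gap0 i : cone_gap (pt t i) (hd x) (bar x) = 0.
  apply/eqP; rewrite cone_gap_eq0 ?hd_le ?(pt_in tS) //.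
  by apply/eqP/tightS; exact: pt_in tS _.
move: l1 lx; rewrite !(big_pt tS) ![l p + _]addrC [l p *: _ + _]addrC => l1 lx.
have [lE xE] := coords_unique Minj l1 lx gap0.
have [rad lpE] : 0 <= radicand t (hd x) /\ l p = alpha_plus t p (hd x).
  apply: alpha_plus_unique; first by rewrite l_ge0 ?fset1U1.
  have := gap0 ord0; rewrite xE cone_gap_curve // => /eqP.
  by rewrite subr_eq0 => /eqP.
split=> //; last by rewrite -lpE.
  by rewrite /curve_point Gamma_plusE -lpE -xE mkptK.
by move=> i; rewrite alphaE -lpE -lE l_ge0 // in_fset1U (pt_in tS) orbT.
Qed.

(** Where the square root breaks down with nonnegative coordinates, the curve
    passes through the convex hull of [S] at a point too far from [S] for its
    level; so no feasible point, such as [x], can be at a higher level. *)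
Lemma radicand_le0 a : a <= hd x -> (forall i, 0 <= alpha t p a i 0) ->
  radicand t a <= 0 -> a = hd x.
Proof.
move=> ax alpha_ge0 rad.
have /eqP ap0 : alpha_plus t p a == 0 by rewrite alpha_plus_eq0.
have [l [lp lE /(barycenterU1 _ _ pS)]] := curve_weights a.
rewrite lp ap0 scale0r !add0r => lG.
apply: le_anti; rewrite ax.
have [q /(pt_onto tS)[i ->]|q /(pt_onto tS)[i ->]||->] // :=
    @level_bound R d S l (Gamma_plus t p a) a x _ lG.
- by rewrite lE.
- apply: ge_enorm; rewrite -subr_ge0 -/(cone_gap _ _ _) Gamma_plusE cone_gap_curve //.
  by rewrite ap0 expr0n mul0r sub0r oppr_ge0.
- exact: tight_feasible.
Qed.

Lemma radicand_ge0 a : a <= hd x -> (forall i, 0 <= alpha t p a i 0) ->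
  0 <= radicand t a.
Proof.
move=> ax alpha_ge0; rewrite leNgt; apply/negP => rad.
have [rad_x _ _ _] := search_start.
have ax_eq := radicand_le0 ax alpha_ge0 (ltW rad).
by move: rad; rewrite ax_eq ltNge rad_x.
Qed.

(** Below [hd x], the root found by [last_zero] has nonnegative coordinates,
    hence a real square root: it counts as a zero for the partial step. *)
Lemma partial_before a k : a <= hd x -> alpha t p a k 0 < 0 ->
  exists c, a < c /\ exists i, partial_set t p (hd x) i c.
Proof.
move=> ax ak; have [_ _ alpha_x _] := search_start.
have [||||c [/andP[ac cx] alpha_c [i ic]]] :=
  @last_zero R _ (fun i a => alpha t p a i 0) a (hd x) k => //.
  by move=> i; exact: alpha_continuous.
exists c; split; last by exists i; split=> //; exact: radicand_ge0.
rewrite lt_def ac andbT; apply/eqP => ca.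
by have := alpha_c k; rewrite ca leNgt ak.
Qed.

(** Otherwise the points of the curve would stay in the convex hull of [S] and
    [p], while their distance to the first point of [t] grows with the depth of
    the level. *)
Lemma partial_nonempty :
  ([set c | exists i, partial_set t p (hd x) i c] !=set0)%classic.
Proof.
apply: contrapT => /set0P/negP; rewrite negbK => /eqP none.
have alpha_ge0 a i : a <= hd x -> 0 <= alpha t p a i 0.
  move=> ax; rewrite leNgt; apply/negP => /(partial_before ax)[c [_ cP]].
  have : [set c | exists i, partial_set t p (hd x) i c]%classic c by [].
  by rewrite none.
pose f q := dot (bar q - bar (pfst t)) (bar q - bar (pfst t)).
pose B := \sum_(q <- (p |` S)%fset) f q.
have f_ge0 q : 0 <= f q by exact: dot_ge0.
have B_ge0 : 0 <= B by apply: sumr_ge0.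
(* At this level the square distance to the first point exceeds the bound B. *)
pose a := hd x - B - 1.
have ax : a <= hd x by rewrite /a; lra.
have rad : 0 <= radicand t a by apply: radicand_ge0 => // i; exact: alpha_ge0.
have [l [lp lE lG]] := curve_weights a.
have l_ge0 q : q \in (p |` S)%fset -> 0 <= l q.
  rewrite in_fset1U => /orP[/eqP ->|/(pt_onto tS)[i ->]].
    by rewrite lp alpha_plus_ge0.
  by rewrite lE alpha_ge0.
have l_le1 q : q \in (p |` S)%fset -> l q <= 1.
  move=> qU; rewrite -lG.1 (big_fsetD1 _ qU) /= lerDl big_seq sumr_ge0 // => q'.
  by rewrite in_fsetD1 => /andP[_ /l_ge0].
have : dot (Gamma_plus t p a - bar (pfst t)) (Gamma_plus t p a - bar (pfst t)) <= B.
  apply: le_trans (_ : \sum_(q <- (p |` S)%fset) l q * f q <= _); last first.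
    rewrite /B big_seq [leRHS]big_seq; apply: ler_sum => q qU.
    by rewrite ler_piMl ?l_le1.
  rewrite /f (huygens (bar (pfst t)) lG.1 lG.2) lerDr big_seq sumr_ge0 // => q qU.
  by rewrite mulr_ge0 ?l_ge0 ?dot_ge0.
have fstS : pfst t \in S by exact: pt_in tS _.
have := curve_tight ax rad fstS; rewrite hd_mkpt bar_mkpt enormB => dist.
rewrite -enorm_sqr dist; apply/negP; rewrite -ltNge.
have : B + 1 <= hd (pfst t) - a by rewrite /a; have := hd_le fstS; lra.
by nra.
Qed.

Lemma partial_exists : exists xp, is_partial t p (hd x) xp.
Proof.
apply: (closed_has_max (b := hd x)); last by move=> c [i []].
- apply: closed_exists => i.
  rewrite [X in closed X](_ : _ = ([set c | (0 <= radicand t c)%R] `&`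
    ([set c | alpha t p c i 0 = 0%R] `&` [set c | (c <= hd x)%R]))%classic).
    apply: closedI; first exact/closed_ge_zero/radicand_continuous.
    by apply: closedI; [exact/closed_zero/alpha_continuous|exact: closed_le].
  by apply/seteqP; split=> c /= => [[? ? ?]|[? [? ?]]]; do !split.
- exact: partial_nonempty.
Qed.

Lemma full_equation a :
  (enorm (qvec t p + a *: rvec t p) ^+ 2 = (hd (pfst t) - a) ^+ 2) <->
  alpha_star t p a ^+ 2 * dot (zvec t p) (zvec t p) = radicand t a.
Proof.
have -> : qvec t p + a *: rvec t p =
    - (bar (pfst t) - curve t p a (alpha_star t p a)).
  rewrite opprB /curve addrK /qvec /rvec /uxv mulmxDr -scalemxAr.
  rewrite scalerDr addrACA scalerA -scalerDl; congr (_ + _ *: _).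
  rewrite /alpha_star /uxv mulmxDr -scalemxAr !dotDr dotZr.
  by ring.
have gap := cone_gap_curve p Minj a (alpha_star t p a) ord0.
rewrite enorm_sqr dotNl dotNr opprK; split=> E.
  by apply/eqP; rewrite -subr_eq0 -gap /cone_gap E subrr.
by apply/eqP; rewrite -subr_eq0 -/(cone_gap _ _ _) gap E subrr.
Qed.

Lemma full_exists : exists xf, is_full t p (hd x) xf.
Proof.
have [F0|/set0P F0] := eqVneq (full_set t p (hd x)) set0.
  by exists -oo%E; left.
have [||a []|m mF] := closed_has_max (A := full_set t p (hd x)) (b := hd x) => //.
- rewrite [X in closed X](_ : _ =
    ([set a | (alpha_star t p a ^+ 2 * dot (zvec t p) (zvec t p) -
               radicand t a)%R = 0%R] `&`
     ([set a | (0 <= alpha_star t p a)%R] `&`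
      ([set a | (a <= hd p)%R] `&` [set a | (a <= hd x)%R])))%classic).
    apply: closedI; last first.
      apply: closedI; first exact/closed_ge_zero/alpha_star_continuous.
      by apply: closedI; exact: closed_le.
    apply: closed_zero => a; apply: cvgB; last exact: radicand_continuous.
    apply: cvgM; last exact: cvg_cst.
    by apply: cvgM; exact: alpha_star_continuous.
  apply/seteqP; split=> a /= => [[/full_equation E ? ? ?]|[E [? [? ?]]]].
    by do !split=> //; rewrite E subrr.
  by split=> //; apply/full_equation/eqP; rewrite -subr_eq0 E.
- by exists m%:E; right; exists m.
Qed.

Lemma cone_gap_pstar a : 0 <= radicand t a -> cone_gap p a (Gamma_plus t p a) =
  2 * dot (zvec t p) (zvec t p) * (alpha_star t p a - alpha_plus t p a).
Proof.
move=> rad; rewrite Gamma_plusE cone_gap_curve_pstar // -Gamma_plusE.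
by rewrite (cone_gap_pt ord0) // add0r dzE.
Qed.

(** The full step looks for the intersection of the curve with the boundary of
    the cone of [p]: at such a point the affine [alpha_star] and the square root
    [alpha_plus] agree. *)
Lemma full_setP a : full_set t p (hd x) a <->
  [/\ 0 <= radicand t a, a <= hd x & enorm (bar p - Gamma_plus t p a) = hd p - a].
Proof.
have gap0 : 0 <= radicand t a -> cone_gap p a (Gamma_plus t p a) = 0 <->
    alpha_star t p a = alpha_plus t p a.
  move=> rad; rewrite cone_gap_pstar //; split=> [|->]; last by rewrite subrr mulr0.
  by move=> /eqP; rewrite !mulf_eq0 pnatr_eq0 /= (gt_eqF zz_gt0) subr_eq0 => /eqP.
split=> [[/full_equation E as_ge0 ap ax]|[rad ax pE]].
  have [rad asE] := alpha_plus_unique as_ge0 E; split=> //.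
  by apply/eqP; rewrite -cone_gap_eq0 //; apply/eqP/gap0.
have ap : a <= hd p by rewrite -subr_ge0 -pE enorm_ge0.
have /gap0 asE : cone_gap p a (Gamma_plus t p a) = 0.
  by apply/eqP; rewrite cone_gap_eq0 // pE.
split=> //; first by apply/full_equation; rewrite asE // alpha_plus_sqr.
by rewrite asE // alpha_plus_ge0.
Qed.

Variable xp : R.
Hypothesis partial_xp : is_partial t p (hd x) xp.

Lemma partial_le : xp <= hd x.
Proof. by case: partial_xp => -[i []]. Qed.

Lemma alpha_ge0_after a i : xp <= a -> a <= hd x -> 0 <= alpha t p a i 0.
Proof.
move=> xpa ax; rewrite leNgt; apply/negP => /(partial_before ax)[c [ac cP]].
by have := partial_xp.2 c cP; rewrite leNgt (le_lt_trans xpa ac).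
Qed.

Lemma radicand_ge0_after a : xp <= a -> a <= hd x -> 0 <= radicand t a.
Proof. by move=> xpa ax; apply: radicand_ge0 => // i; exact: alpha_ge0_after. Qed.

(** If the point of the curve at level [xp] satisfied the constraint of [p]
    strictly, then this constraint would have become tight in between, and the
    full step would have been the shorter one. *)
Lemma still_violated (xf : \bar R) : is_full t p (hd x) xf -> (xf <= xp%:E)%E ->
  hd p - xp <= enorm (bar p - Gamma_plus t p xp).
Proof.
move=> full_xf xf_xp; rewrite leNgt; apply/negP => inside.
have xpx := partial_le; have [_ start_x _ _] := search_start.
have rad_xp := radicand_ge0_after (lexx _) xpx.
have xpp : xp <= hd p.
  by rewrite -subr_ge0 ltW // (le_lt_trans (enorm_ge0 _) inside).
pose h a := alpha_star t p a - alpha_plus t p a.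
have h_xp : h xp < 0.
  have := cone_gap_pstar rad_xp; rewrite /cone_gap -enorm_sqr -/(h xp) => E.
  rewrite -(@pmulr_rlt0 _ (2 * dot (zvec t p) (zvec t p))) ?mulr_gt0 //.
  by rewrite -E subr_lt0 ltr_sqr ?nnegrE ?enorm_ge0 // subr_ge0.
(* Above the level of [p], the sign of the squared equation says nothing. *)
pose e := Num.min (hd x) (hd p).
have xpe : xp <= e by rewrite le_min xpx.
have ex : e <= hd x by rewrite ge_min lexx.
have ep : e <= hd p by rewrite ge_min lexx orbT.
have h_e : 0 <= h e.
  rewrite -(@pmulr_rge0 _ (2 * dot (zvec t p) (zvec t p))) ?mulr_gt0 //.
  rewrite -cone_gap_pstar ?radicand_ge0_after // /cone_gap subr_ge0.
  have [xp_le|px] := leP (hd x) (hd p); last first.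
    by rewrite /e (min_idPr (ltW px)) subrr expr0n dot_ge0.
  rewrite /e (min_idPl xp_le) -enorm_sqr ler_sqr ?nnegrE ?enorm_ge0 ?subr_ge0 //.
  have -> : Gamma_plus t p (hd x) = bar x by rewrite -[in RHS]start_x bar_mkpt.
  by case: inv.
have hc : continuous h.
  move=> a; apply: cvgB; first exact: alpha_star_continuous.
  exact: alpha_plus_continuous.
have [c /andP[xpc ce] hc0] := IVT_zero hc xpe (ltW h_xp) h_e.
have cx := le_trans ce ex.
have rad_c := radicand_ge0_after xpc cx.
have c_full : full_set t p (hd x) c.
  apply/full_setP; split=> //; apply/eqP; rewrite -cone_gap_eq0 ?(le_trans ce ep) //.
  by rewrite cone_gap_pstar // -/(h c) hc0 mulr0.
case: full_xf => [[F0 _]|[m [_ m_max] xfm]]; first by move: c_full; rewrite F0.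
move: xf_xp; rewrite xfm lee_fin => /(le_trans (m_max c c_full)) cxp.
have cE : c = xp by apply: le_anti; rewrite cxp xpc.
by move: h_xp; rewrite -cE hc0 ltxx.
Qed.

(** The point that leaves has coordinate zero.  If the coefficient of [p] is
    zero too, then by [radicand_le0] the step has length zero, and the point
    [x] is still strictly violated. *)
Lemma partial_step k (xf : \bar R) : partial_set t p (hd x) k xp ->
  is_full t p (hd x) xf -> (xf <= xp%:E)%E ->
  search_inv (S `\ tnth t k)%fset p (curve_point t p xp) /\
  (hd (curve_point t p xp) = hd x -> curve_point t p xp = x).
Proof.
case=> rad_xp ak xpx full_xf xf_xp; have [_ start_x _ start_p] := search_start.
have atx : xp = hd x -> curve_point t p xp = x by move=> ->.
split; last by rewrite hd_mkpt.
have sub : (p |` (S `\ tnth t k) `<=` p |` S)%fset by rewrite fsetUS ?fsubD1set.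
have [l [lp lE lG]] := curve_weights xp.
split.
- by rewrite in_fsetD1 negb_and pS orbT.
- exact: sub_independent sub ind.
- by move=> q /fsetD1P[_ qS]; exact: curve_tight.
- by rewrite hd_mkpt bar_mkpt; exact: still_violated full_xf xf_xp.
exists l; split.
- move=> q /(fsubsetP sub); rewrite in_fset1U => /orP[/eqP ->|/(pt_onto tS)[i ->]].
    by rewrite lp alpha_plus_ge0.
  by rewrite lE alpha_ge0_after.
- rewrite bar_mkpt; apply: barycenterD1 lG => //; first exact: pt_in tS k.
  by rewrite lE.
- have [ap0|/negPf ap0] := eqVneq (alpha_plus t p xp) 0; last first.
    by left; rewrite lp lt_def ap0 alpha_plus_ge0.
  have xpE : xp = hd x.
    apply: radicand_le0 => //; last by rewrite -alpha_plus_eq0 ap0.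
    by move=> i; exact: alpha_ge0_after.
  right; rewrite (atx xpE); case: start_p => //.
  by rewrite -xpE ap0 ltxx.
Qed.

(** A zero coefficient of [p] would put the point of the full step at the level
    [hd x], where the constraint of [p] was strictly violated. *)
Lemma full_step c : is_max (full_set t p (hd x)) c -> xp < c ->
  [/\ certified (p |` S)%fset (curve_point t p c), c <= hd x
    & c = hd x -> soc_le x p].
Proof.
move=> [/full_setP[rad_c cx pE] _] xpc; have [_ start_x _ start_p] := search_start.
have tight_c : tight (p |` S)%fset (curve_point t p c).
  move=> q; rewrite in_fset1U => /orP[/eqP ->|]; last exact: curve_tight.
  by rewrite hd_mkpt bar_mkpt.
have soc_p : c = hd x -> soc_le x p.
  move=> cE; rewrite -start_x -cE; apply: (tight_feasible tight_c).
  exact: fset1U1.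
split=> //; have [l [lp lE lG]] := curve_weights c.
split=> //; exists l; last by rewrite bar_mkpt.
move=> q; rewrite in_fset1U => /orP[/eqP ->|/(pt_onto tS)[i ->]].
  rewrite lp lt_def alpha_plus_ge0 andbT alpha_plus_eq0; apply/negP => rad_le.
  have cE : c = hd x.
    by apply: radicand_le0 => // i; apply: alpha_ge0_after => //; exact: ltW.
  case: start_p => [|/negP]; last by move/(_ (soc_p cE)).
  by rewrite -cE lt_def alpha_plus_eq0 rad_le.
rewrite lE lt_def alpha_ge0_after ?(ltW xpc) // andbT; apply/eqP => ai.
have /partial_xp.2 : [set c | exists i, partial_set t p (hd x) i c]%classic c.
  by exists i.
by rewrite leNgt xpc.
Qed.

End Search.

(** * Steps leaving an optimality check *)

Section Steps.
Variables (R : realType) (d : nat).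
Local Notation V := 'cV[R]_(1 + d).
Implicit Types (S T : {fset V}) (p q x y : V).

Lemma certified_violated S x p : certified S x -> ~~ soc_le x p -> p \notin S.
Proof.
by case=> tS _ _; apply: contra => pS; rewrite soc_leE tS.
Qed.

Lemma enter_independent S x p s (t : s.+1.-tuple V) :
  certified S x -> ~~ soc_le x p -> enumerates t S -> zvec t p != 0 ->
  search_inv S p x.
Proof.
move=> cS px tS z0; have [tightS indS [l l_gt0 lx]] := cS.
have [pS ind] := zvec_independent tS indS z0.
split=> //; first by move: px; rewrite soc_leE -ltNge => /ltW.
exists (fun q => if q == p then 0 else l q); split; last by right.
  by move=> q; rewrite in_fset1U; case: eqP => //= _ /l_gt0/ltW.
apply/barycenterU1 => //; rewrite eqxx scale0r !add0r -lx.2 -lx.1.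
by split; apply: eq_big_seq => q qS; case: eqP => // qp; rewrite -qp qS in pS.
Qed.

Lemma dependent_index_exists s (t : s.+1.-tuple V) p (a : R) :
  exists k, dependent_index t p a k.
Proof.
have [i0 i0_lt0] : exists i : 'I_s.+1, sigma t p i 0 < 0.
  apply: contrapT => none; have := ltrN10 R; rewrite -(sigma_sum t p).
  rewrite ltNge sumr_ge0 // => i _; rewrite leNgt; apply/negP => si.
  by case: none; exists i.
case: (@arg_minP _ _ _ i0 (fun i : 'I_s.+1 => sigma t p i 0 < 0)
  (fun i : 'I_s.+1 => - rho t a i 0 / sigma t p i 0) i0_lt0) => k sk k_min.
by exists k.
Qed.

(** Moving along the affine dependency between [p] and [S] keeps the point [x]
    in place and shifts weight to [p]; the ratio test stops at the first
    coordinate to vanish. *)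
Lemma enter_dependent S x p s (t : s.+1.-tuple V) k :
  certified S x -> ~~ soc_le x p -> enumerates t S -> zvec t p = 0 ->
  dependent_index t p (hd x) k -> search_inv (S `\ tnth t k)%fset p x.
Proof.
move=> cS px tS z0 [sk k_min]; have [tightS indS [l l_gt0 lx]] := cS.
have pS := certified_violated cS px.
have Minj := Mmx_inj_independent tS indS.
have kS : tnth t k \in S by exact: pt_in tS k.
have pSk : p \notin (S `\ tnth t k)%fset by rewrite in_fsetD1 negb_and pS orbT.
split=> //.
- move=> m m0 mb.
  (* Eliminating [p] by its dependency on [S] turns an affine relation between
     [p] and the remaining points into one between the points of [S], whose
     coefficient at the leaving point is that of [p] times [- sigma]. *)
  have [sg sgE] := weights_of tS (fun i => sigma t p i 0).
  have sg_sum : \sum_(q <- S) sg q = - 1.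
    by rewrite (big_pt tS) -(sigma_sum t p); apply: eq_bigr => i _; rewrite sgE.
  have sg_bar : \sum_(q <- S) sg q *: bar q = - bar p.
    apply/eqP; rewrite -addr_eq0 -[X in _ == X]z0 -(sigma_comb t p) (big_pt tS).
    by apply/eqP; congr (_ + _); apply: eq_bigr => i _; rewrite sgE.
  pose mk q := if q == tnth t k then 0 else m q.
  have mk_sum (W : nmodType) (F : V -> R -> W) : (forall q, F q 0 = 0) ->
      \sum_(q <- S) F q (mk q) = \sum_(q <- (S `\ tnth t k)%fset) F q (m q).
    move=> F0; rewrite (big_fsetD1 _ kS) /= {1}/mk eqxx F0 add0r.
    by apply: eq_big_seq => q /fsetD1P[/negPf qk _]; rewrite /mk qk.
  rewrite !big_fsetU1 //= in m0 mb.
  have mk0 : \sum_(q <- S) mk q = - m p.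
    apply/eqP; rewrite -addr_eq0 addrC -[X in _ == X]m0; apply/eqP; congr (_ + _).
    exact: (mk_sum _ (fun=> id)).
  have mkb : \sum_(q <- S) mk q *: bar q = - (m p *: bar p).
    apply/eqP; rewrite -addr_eq0 addrC (mk_sum _ (fun q c => c *: bar q)) ?mb //.
    by move=> q; rewrite scale0r.
  have m'0 q : q \in S -> mk q - m p * sg q = 0.
    apply: (indS (fun q => mk q - m p * sg q)).
      by rewrite sumrB -mulr_sumr sg_sum mk0; ring.
    under eq_bigr do rewrite scalerBl -scalerA.
    by rewrite sumrB -scaler_sumr sg_bar mkb scalerN opprK addNr.
  have mp0 : m p = 0.
    have /eqP := m'0 _ kS; rewrite /mk eqxx sub0r oppr_eq0 mulf_eq0 -/(pt t k) sgE.
    by rewrite (lt_eqF sk) orbF => /eqP.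
  move=> q; rewrite in_fset1U => /orP[/eqP -> //|/fsetD1P[/negPf qk qS]].
  by have := m'0 q qS; rewrite /mk qk mp0 mul0r subr0.
- by move=> q /fsetD1P[_]; exact: tightS.
- by move: px; rewrite soc_leE -ltNge => /ltW.
- pose b := - rho t (hd x) k 0 / sigma t p k 0.
  have gap0 i : cone_gap (pt t i) (hd x) (bar x) = 0.
    have iS := pt_in tS i; apply/eqP; rewrite cone_gap_eq0; first exact/eqP/tightS.
    by rewrite -subr_ge0 -tightS ?enorm_ge0.
  have l1 : \sum_i l (pt t i) + 0 = 1 by rewrite addr0 -(big_pt tS) lx.1.
  have lE : \sum_i l (pt t i) *: bar (pt t i) + 0 *: bar p = bar x.
    by rewrite scale0r addr0 -(big_pt tS (fun q => l q *: bar q)) lx.2.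
  have [rhoE xE] := coords_unique Minj l1 lE gap0.
  have {}rhoE i : l (pt t i) = rho t (hd x) i 0.
    by rewrite rhoE /coords scale0r addr0.
  have rho_ge0 i : 0 <= rho t (hd x) i 0 by rewrite -rhoE ltW ?l_gt0 ?(pt_in tS).
  have b_ge0 : 0 <= b by rewrite /b mulr_le0 ?oppr_le0 ?invr_le0 ?(ltW sk).
  have {}xE : bar x = curve t p (hd x) b.
    by rewrite xE /curve z0 !scaler0.
  have [l' [l'p l'E l'x]] := weights_curve tS (hd x) b pS.
  have l'k : l' (tnth t k) = 0.
    rewrite -/(pt t k) l'E /coords mxE [X in _ + X]mxE /b.
    by rewrite divfK ?lt_eqF // subrr.
  exists l'; split; last by right.
    move=> q; rewrite in_fset1U => /orP[/eqP ->|/fsetD1P[_ /(pt_onto tS)[i ->]]].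
      by rewrite l'p.
    rewrite l'E /coords mxE [X in _ + X]mxE.
    have [si|si] := leP 0 (sigma t p i 0).
      exact: addr_ge0 (rho_ge0 i) (mulr_ge0 b_ge0 si).
    by have := k_min i si; rewrite -/b ler_ndivlMr // -lerBlDl sub0r.
  by rewrite xE; apply: barycenterD1 l'x.
Qed.

Lemma search_fset0 p x : search_inv fset0 p x ->
  [/\ bar x = bar p, hd p <= hd x & hd p = hd x -> x = p].
Proof.
case=> _ _ _ near_p [l [_ [l1 lx] _]].
move: l1 lx; rewrite !fsetU0 !big_seq_fset1 => -> /esym; rewrite scale1r => xp.
split=> //; last by move=> ?; apply: eq_pt.
by move: near_p; rewrite xp subrr /enorm dot0r sqrtr0 subr_le0.
Qed.

Lemma certified_fset1_inv p x : certified [fset p]%fset x -> x = p.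
Proof.
case=> tp _ [l _ [l1 lx]].
move: l1 lx; rewrite !big_seq_fset1 => -> /esym; rewrite scale1r => xp.
apply: eq_pt => //; have := tp p; rewrite inE eqxx xp subrr /enorm dot0r sqrtr0.
by move=> /(_ isT)/eqP; rewrite eq_sym subr_eq0 => /eqP.
Qed.

(** When neither point dominates the other, the solution divides the segment
    between their projections into the two positive distances [A] and [B]
    prescribed by the level. *)
Lemma two_points_certified p1 p : ~~ soc_le p1 p -> ~~ soc_le p p1 ->
  certified [fset p1; p]%fset (two_point_solution p1 p) /\
  hd (two_point_solution p1 p) < hd p1.
Proof.
rewrite !soc_leE (enormB (bar p)) -!ltNge => p1p pp1.
set D := enorm (bar p1 - bar p) in p1p pp1 *.
pose a := (hd p1 + hd p - D) / 2.
pose A := hd p1 - a; pose B := hd p - a.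
have A_gt0 : 0 < A by rewrite /A /a; lra.
have B_gt0 : 0 < B by rewrite /B /a; lra.
have ABD : A + B = D by rewrite /A /B /a; field.
have D_gt0 : 0 < D by rewrite -ABD addr_gt0.
have p1_neq_p : p1 != p.
  by apply: contraTneq D_gt0 => p1E; rewrite /D p1E subrr /enorm dot0r sqrtr0 ltxx.
have -> : two_point_solution p1 p = mkpt a ((A / D) *: bar p + (B / D) *: bar p1).
  rewrite /two_point_solution -/D -/a.
  have -> : Num.min (hd p1) (Num.min (hd p) a) = a.
    by rewrite !(min_idPr _) // ?(min_idPr _) // -subr_ge0 ltW.
  by rewrite -/A -/B ABD scalerDr !scalerA ![D^-1 * _]mulrC.
rewrite hd_mkpt -subr_gt0; split=> //.
have p1N : p1 \notin [fset p]%fset by rewrite in_fset1.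
have enormZ c (v : 'cV[R]_d) : 0 <= c -> enorm (c *: v) = c * enorm v.
  move=> c0; apply: enorm_eqP; first by rewrite mulr_ge0 ?enorm_ge0.
  by rewrite exprMn enorm_sqr !dot_linear; ring.
have BE : B / D = 1 - A / D by rewrite -ABD; field; rewrite ABD gt_eqF.
split.
- move=> q; rewrite in_fset2 hd_mkpt bar_mkpt => /orP[]/eqP ->; rewrite -/A -/B.
    have -> : bar p1 - (A / D *: bar p + B / D *: bar p1) = (A / D) *: (bar p1 - bar p).
      by rewrite BE; apply/colP => j; rewrite !mxE; ring.
    by rewrite enormZ ?divr_ge0 ?ltW // -/D divfK ?gt_eqF.
  have -> : bar p - (A / D *: bar p + B / D *: bar p1) = (B / D) *: (bar p - bar p1).
    by rewrite BE; apply/colP => j; rewrite !mxE; ring.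
  by rewrite enormZ ?divr_ge0 ?ltW // enormB -/D divfK ?gt_eqF.
- move=> l; rewrite !big_fsetU1 // !big_seq_fset1 /= => l0 lb.
  have lpE : l p = - l p1 by apply/eqP; rewrite -addr_eq0 addrC l0.
  have lp1 : l p1 = 0.
    move/eqP: lb; rewrite lpE scaleNr -scalerBr scaler_eq0 -enorm_eq0.
    rewrite -/D (gt_eqF D_gt0) orbF.
    by move/eqP.
  by move=> q; rewrite in_fset2 => /orP[]/eqP ->; rewrite ?lpE lp1 ?oppr0.
- exists (fun q => if q == p then A / D else B / D).
    by move=> q _; case: ifP; rewrite divr_gt0.
  split; rewrite !big_fsetU1 // !big_seq_fset1 /= eqxx (negPf p1_neq_p).
    by rewrite BE subrK.
  by rewrite bar_mkpt addrC.
Qed.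

End Steps.

(** * The initial pair and the support set *)

Section Extremes.
Variables (R : realType) (d : nat).
Local Notation V := 'cV[R]_(1 + d).
Implicit Types (S T : {fset V}) (p q k x y : V).

Lemma bar_section S : {in S &, injective (@bar R d)} ->
  exists g : 'cV[R]_d -> V, forall q, q \in S -> g (bar q) = q.
Proof.
move=> inj; exists (fun b => nth 0 S (find (fun q => bar q == b) S)) => q qS.
have hasq : has (fun q' => bar q' == bar q) S by apply/hasP; exists q.
apply: inj => //; first by rewrite mem_nth -?has_find.
exact/eqP/(nth_find 0 hasq).
Qed.

Lemma hull_barycenter S (y : 'cV[R]_d) : {in S &, injective (@bar R d)} ->
  conv_hull [set` bars S]%classic y ->
  exists2 l, forall q, 0 <= l q & barycenter S l y.
Proof.
move=> /bar_section[g gK] [n [a [m [aS m_ge0 m1 ->]]]].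
have gaS i : g (a i) \in S /\ bar (g (a i)) = a i.
  by have /imfsetP[q /= qS ->] := aS i; rewrite gK.
exists (fun q => \sum_(i | g (a i) == q) m i) => [q|]; first exact: sumr_ge0.
have regroup (W : nmodType) (F : 'I_n -> W) :
    \sum_(q <- S) \sum_(i | g (a i) == q) F i = \sum_i F i.
  under eq_bigr do rewrite big_mkcond; rewrite exchange_big /=.
  apply: eq_bigr => i _.
  rewrite (big_fsetD1 _ (gaS i).1) /= eqxx big_seq big1 ?addr0 //.
  by move=> q /fsetD1P[/negPf qN _]; rewrite eq_sym qN.
split; first by rewrite regroup.
rewrite -[RHS]regroup; apply: eq_bigr => q _; rewrite scaler_suml.
by apply: eq_bigr => i /eqP <-; rewrite (gaS i).2.
Qed.

Lemma barycenter_aff_hull S l (y : 'cV[R]_d) :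
  barycenter S l y -> aff_hull (conv_hull [set` bars S])%classic y.
Proof.
move=> lb; have [q qS] := barycenter_in lb; case: lb => l1 <-.
have [s [t [tS _]]] := enumerates_exists qS.
exists s.+1, (fun i => bar (pt t i)), (fun i => l (pt t i)); split.
- move=> i; exists 1%N, (fun=> bar (pt t i)), (fun=> 1); split.
  + by move=> _; apply/imfsetP; exists (pt t i) => //; exact: pt_in.
  + by move=> _; exact: ler01.
  + by rewrite big_ord1.
  + by rewrite big_ord1 scale1r.
- by rewrite -(big_pt tS).
- by rewrite (big_pt tS).
Qed.

Lemma independent_bars S : {in S &, injective (@bar R d)} ->
  affinely_independent (bars S) -> independent S.
Proof.
move=> inj ind l l0 lb q qS; have [g gK] := bar_section inj.
rewrite -[q in LHS]gK //; apply: (ind (l \o g)); last by apply/imfsetP; exists q.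
  by rewrite big_imfset //= -[RHS]l0; apply: eq_big_seq => q' /gK/= ->.
by rewrite big_imfset //= -[RHS]lb; apply: eq_big_seq => q' /gK/= ->.
Qed.

Lemma independent_unique S l m (y : 'cV[R]_d) : independent S ->
  barycenter S l y -> barycenter S m y -> forall q, q \in S -> l q = m q.
Proof.
move=> ind [l1 ly] [m1 my] q qS; apply/eqP; rewrite -subr_eq0; apply/eqP.
apply: (ind (fun q => l q - m q)) => //; first by rewrite sumrB l1 m1 subrr.
by under eq_bigr do rewrite scalerBl; rewrite sumrB ly my subrr.
Qed.

(** If the coordinate of [x] at [k] were zero, moving [x] slightly away from
    [k] would lead out of the convex hull but not out of the affine hull. *)
Lemma dual_feasible_certified S x : dual_feasible_pair S x -> certified S x.
Proof.
case=> tS [hull_x [e e_gt0 near_x]] indB.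
have inj : {in S &, injective (@bar R d)}.
  move=> p q pS qS pq; apply: eq_pt => //.
  by have := tS p pS; rewrite pq tS // => /addIr.
have ind := independent_bars inj indB.
have [l l_ge0 lx] := hull_barycenter inj hull_x.
split=> //; exists l => // k kS; rewrite lt_def l_ge0 andbT; apply/eqP => lk0.
pose r := e / (enorm (bar x - bar k) + 1).
have N_gt0 : 0 < enorm (bar x - bar k) + 1 by rewrite ltr_pwDr ?enorm_ge0.
have r_gt0 : 0 < r by rewrite divr_gt0.
pose y := bar x + r *: (bar x - bar k).
pose ly q := (1 + r) * l q - (if q == k then r else 0).
have pick (W : nmodType) (F : V -> W) :
    \sum_(q <- S) (if q == k then F q else 0) = F k.
  rewrite (big_fsetD1 _ kS) /= eqxx big_seq big1 ?addr0 // => q.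
  by case/fsetD1P => /negPf ->.
have ly_y : barycenter S ly y.
  split; first by rewrite sumrB -mulr_sumr lx.1 (pick _ (fun=> r)); ring.
  under eq_bigr do rewrite scalerBl -scalerA.
  rewrite sumrB -scaler_sumr lx.2.
  under [X in _ - X]eq_bigr do rewrite (fun_if (fun c => c *: _)) scale0r.
  rewrite (pick _ (fun q => r *: bar q)) /y scalerDl scale1r scalerBr.
  by rewrite addrA.
have near : enorm (y - bar x) < e.
  rewrite /y addrC addKr.
  have -> : enorm (r *: (bar x - bar k)) = r * enorm (bar x - bar k).
    apply: enorm_eqP; first by rewrite mulr_ge0 ?enorm_ge0 ?ltW.
    by rewrite exprMn enorm_sqr dotZl dotZr; ring.
  by rewrite /r mulrAC ltr_pdivrMr // ltr_pM2l // ltrDl.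
have [m m_ge0 my] := hull_barycenter inj (near_x y (barycenter_aff_hull ly_y) near).
have := m_ge0 k; rewrite (independent_unique ind my ly_y kS) /ly lk0 eqxx.
by rewrite mulr0 sub0r oppr_ge0 leNgt r_gt0.
Qed.

(** Affine independence gives a direction [h] in which [x] approaches all points
    of [S] but one, at a common rate; hence the level can be raised as soon as
    the constraint of this point is dropped. *)
Lemma certified_support S x : certified S x -> support_set S.
Proof.
move=> cS T TS InfT; have [tightS indS [l l_gt0 lx]] := cS.
have xT : Inf T x by rewrite InfT; exact: certified_Inf.
have TsubS := fsubsetP (fproper_sub TS).
have /fsubsetPn[k kS kT] : ~~ (S `<=` T)%fset.
  by move: TS; rewrite fproperE => /andP[].
have [s [t [tS tk]]] := enumerates_exists kS.
have Minj := Mmx_inj_independent tS indS.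
pose h : 'cV[R]_d := Mmx t *m (Gram_inv t *m const_mx 1).
have dot_h q : q \in S -> q != k -> dot (bar q - bar k) h = 1.
  move=> /(pt_onto tS)[i ->]; case: (unliftP ord0 i) => [i' ->|->]; last first.
    by rewrite -/(pfst t) tk eqxx.
  rewrite -tk -trMmxE /h mulmxA /Gram_inv mulKVmx ?Gram_unit //.
  by rewrite mxE.
have lk := l_gt0 k kS.
have dot_xk : dot (bar x - bar k) h = 1 - l k.
  have [l1 <-] := lx; rewrite -[bar k]scale1r -l1 scaler_suml -sumrB.
  rewrite dotC dot_sumr (big_fsetD1 _ kS) [in RHS](big_fsetD1 _ kS) /=.
  rewrite subrr dot0r add0r addrC addrK.
  apply: eq_big_seq => q /fsetD1P[qk qS].
  by rewrite -scalerBr dotZr dotC dot_h // mulr1.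
have dot_xh q : q \in T -> dot (bar q - bar x) h = l k.
  move=> qT; have qk : q != k by apply: contraNneq kT => <-.
  have := dot_h q (TsubS q qT) qk; move: dot_xk; rewrite !dot_linear; lra.
pose H := dot h h; have H_ge0 : 0 <= H by exact: dot_ge0.
(* Moving by [e *: h] lowers the square distance to each point of [T]
   by [2 * e * l k - e ^+ 2 * H],
   which is at least [e * l k] for this [e]. *)
pose e := l k / (H + 1).
have e_gt0 : 0 < e by rewrite divr_gt0 // ltr_pwDr.
have eH : e * H + e = l k by rewrite /e; field; rewrite gt_eqF // ltr_pwDr.
pose r q := hd q - hd x.
have r_ge0 q : q \in S -> 0 <= r q.
  by move=> qS; rewrite -[r q](tightS q qS) enorm_ge0.
pose B := 1 + \sum_(q <- S) r q.
have rB q : q \in S -> r q <= B.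
  move=> qS; rewrite /B (big_fsetD1 _ qS) /= addrCA lerDl addr_ge0 // big_seq.
  by rewrite sumr_ge0 // => q' /fsetD1P[_ /r_ge0].
have B_gt0 : 0 < B.
  by apply: ltr_pwDl => //; rewrite big_seq sumr_ge0.
(* Raising the level by [eta] then costs at most [2 * eta * B = e * l k]. *)
pose eta := e * l k / (2 * B).
have eta_gt0 : 0 < eta by apply: divr_gt0; apply: mulr_gt0.
have etaB : eta * B * 2 = e * l k by rewrite /eta; field; rewrite gt_eqF.
have yT : Inf_feasible T (mkpt (hd x + eta) (bar x + e *: h)).
  move=> q qT; have qS := TsubS q qT.
  have rq := rB q qS; have rq0 := r_ge0 q qS.
  have dist : dot (bar q - (bar x + e *: h)) (bar q - (bar x + e *: h)) =
      r q ^+ 2 - 2 * e * l k + e ^+ 2 * H.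
    rewrite -[r q](tightS q qS) enorm_sqr -(dot_xh q qT) opprD addrA.
    by move: (bar q - bar x) => u; rewrite !dot_linear [dot h u]dotC /H; ring.
  have dist_ge0 := dot_ge0 (bar q - (bar x + e *: h)); rewrite dist in dist_ge0.
  have r2 : e * l k <= r q ^+ 2 by nra.
  have eta_r : eta * 2 <= r q.
    rewrite -(ler_pM2r B_gt0) mulrAC etaB; apply: le_trans r2 _.
    by rewrite expr2 ler_wpM2l.
  rewrite soc_leE hd_mkpt bar_mkpt.
  have -> : hd q - (hd x + eta) = r q - eta by rewrite /r; ring.
  rewrite enorm_le ?dist; last by lra.
  have : eta * r q <= eta * B by rewrite ler_wpM2l // ltW.
  by nra.
by have := xT.2 _ yT; rewrite hd_mkpt gerDl leNgt eta_gt0.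
Qed.

End Extremes.

(** * Termination and correctness *)

Section Algorithm.
Variables (R : realType) (d : nat) (P : {fset 'cV[R]_(1 + d)}).
Local Notation V := 'cV[R]_(1 + d).
Implicit Types (S : {fset V}) (p q x : V) (st : state R d).

Definition state_inv st : Prop :=
  match st with
  | Check T x => (T `<=` P)%fset /\ certified T x
  | Search p T x => [/\ (T `<=` P)%fset, p \in P & search_inv T p x]
  end.

Definition level_count (A : set R) : nat :=
  #|` [fset S in fpowerset P | `[< exists2 x, certified S x & A (hd x) >]]%fset|.

(** The levels at which a later optimality check can take place.  When the
    constraint of the entering point has become tight during a search, the next
    check may take place at the current level. *)
Definition reachable_levels st : set R :=
  match st with
  | Check _ x => [set a | a < hd x]
  | Search p _ x => [set a | a < hd x \/ (soc_le x p /\ a = hd x)]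
  end%classic.

(** Lexicographic: each new check uses up the level of its set, and the searches
    in between make the set smaller. *)
Definition rank st : nat :=
  (level_count (reachable_levels st) * (#|` P| + 2) +
   match st with Check _ _ => #|` P| + 1 | Search _ T _ => #|` T| end)%N.

Lemma level_count_le (A B : set R) : (A `<=` B)%classic ->
  (level_count A <= level_count B)%N.
Proof.
move=> AB; apply/fsubset_leq_card/fsubsetP => S; rewrite !inE /=.
case/andP=> -> /asboolP[x cS Ax] /=; apply/asboolP.
by exists x => //; exact: AB.
Qed.

(** A set is certified at one level only, that of its unique solution; so a
    certified set is lost when its level is. *)
Lemma level_count_lt (A B : set R) S x : (A `<=` B)%classic ->
  (S `<=` P)%fset -> certified S x -> B (hd x) -> ~ A (hd x) ->
  (level_count A < level_count B)%N.
Proof.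
move=> AB SP cS Bx Ax; apply: fproper_ltn_card; rewrite fproperE; apply/andP; split.
  apply/fsubsetP => T; rewrite !inE /=.
  by case/andP=> -> /asboolP[y cT Ay] /=; apply/asboolP; exists y => //; exact: AB.
apply/negP => /fsubsetP/(_ S); rewrite !inE /= fpowersetE SP /=.
have -> : `[< exists2 x, certified S x & B (hd x) >] by apply/asboolP; exists x.
move=> /(_ isT)/asboolP[y cy Ay]; apply: Ax.
have xy : Inf_feasible S x by apply: tight_feasible; case: cS.
have yx : Inf_feasible S y by apply: tight_feasible; case: cy.
rewrite (_ : hd x = hd y) //; apply: le_anti.
by rewrite (certified_optimal cy xy).1 (certified_optimal cS yx).1.
Qed.

Lemma rank_check st S x : (S `<=` P)%fset -> certified S x ->
  reachable_levels st (hd x) -> (rank (Check S x) < rank st)%N.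
Proof.
move=> SP cS x_st.
have : (level_count (reachable_levels (Check S x)) <
        level_count (reachable_levels st))%N.
  apply: level_count_lt SP cS _ _ => //=; last by rewrite ltxx.
  move=> a /= ax; case: st x_st => [T y|p T y] /=; first exact: lt_trans.
  by case=> [xy|[_ <-]]; left=> //; exact: lt_trans xy.
rewrite /rank; nia.
Qed.

Lemma rank_search st p S x : (S `<=` P)%fset ->
  (reachable_levels (Search p S x) `<=` reachable_levels st)%classic ->
  (match st with Check _ _ => True | Search _ T _ => (#|` S| < #|` T|)%N end) ->
  (rank (Search p S x) < rank st)%N.
Proof.
move=> SP /level_count_le le_st; rewrite /rank.
have := fsubset_leq_card SP.
by case: st le_st => [T y|q T y] /=; nia.
Qed.

Lemma step_inv st st' : step P st st' -> state_inv st ->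
  state_inv st' /\ (rank st' < rank st)%N.
Proof.
case=> {st st'} [S x p pP px dom|p1 x p [pP px ndom]|S x p s t [pP px _] tS z0
  |S x p s t k [pP px _] tS z0 dep_k|S x p s t k xp xf tS part part_k full le_x
  |S x p s t xp xf tS part full lt_x|x p] /=.
- case=> SP cS; have p1P : ([fset p] `<=` P)%fset by rewrite fsub1set.
  have cp := certified_fset1 p; split; first by [].
  apply: rank_check => //=.
  have [le_x eq_x] := certified_optimal cS dom.
  rewrite lt_def le_x andbT; apply: contraNneq px => /esym/eq_x <-.
  exact: soc_lexx.
- case=> p1P cp1; have xp1 := certified_fset1_inv cp1; rewrite xp1 in px *.
  have npp1 : ~~ soc_le p p1.
    by apply/negP => pp1; case: ndom => q /fset1P ->.
  have [c lt_c] := two_points_certified px npp1.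
  have p1pP : ([fset p1; p] `<=` P)%fset by rewrite fsubUset p1P fsub1set.
  by split=> //; exact: rank_check.
- case=> SP cS; split.
    split=> //; apply: enter_independent px tS _ => //.
    by rewrite -enorm_eq0; apply/eqP.
  apply: rank_search => //= a /=; case=> // -[xp _].
  by rewrite xp in px.
- case=> SP cS; have SkP := fsubset_trans (fsubD1set S (tnth t k)) SP.
  split.
    split=> //; apply: enter_dependent cS px tS _ dep_k.
    by apply/eqP; rewrite -enorm_eq0 z0.
  apply: rank_search => //= a /=; case=> // -[xp _].
  by rewrite xp in px.
- case=> SP pP inv; have SkP := fsubset_trans (fsubD1set S (tnth t k)) SP.
  have [inv' same] := partial_step tS inv part part_k full le_x.
  have xpx := partial_le part.
  split=> //; apply: rank_search => //=; last first.
    apply: fproper_ltn_card; apply: fproperD1.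
    exact: pt_in tS k.
  move=> a; rewrite /= !hd_mkpt => -[ax|[xp_p ->]].
    by left; exact: lt_le_trans xpx.
  move: xpx; rewrite le_eqVlt => /orP[/eqP xpE|]; last by left.
  by right; rewrite -{1}same // hd_mkpt.
- case=> SP pP inv.
  have [c c_max xfE] : exists2 c, is_max (full_set t p (hd x)) c & xf = c%:E.
    by case: full => // -[_ xfN]; rewrite xfN ltNge leNye in lt_x.
  rewrite xfE lte_fin /= in lt_x *.
  have [cert cx c_eq] := full_step tS inv part c_max lt_x.
  have pSP : (p |` S `<=` P)%fset by rewrite fsubUset fsub1set pP.
  split=> //; apply: rank_check => //=; rewrite hd_mkpt.
  move: cx; rewrite le_eqVlt => /orP[/eqP cxE|]; last by left.
  by right; split=> //; exact: c_eq.
- case=> _ pP inv; have [xp le_x eq_x] := search_fset0 inv.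
  have pP1 : ([fset p] `<=` P)%fset by rewrite fsub1set.
  have cp := certified_fset1 p; split=> //; apply: rank_check => //=.
  move: le_x; rewrite le_eqVlt => /orP[/eqP pxE|]; last by left.
  by right; split=> //; rewrite eq_x // soc_lexx.
Qed.

Lemma reachable_inv st st' : reachable P st st' -> state_inv st -> state_inv st'.
Proof. by elim=> // [{}st {}st' /step_inv h /h[]|x y z _ h1 _ h2 /h1]. Qed.

Lemma no_infinite_run (run : nat -> state R d) : state_inv (run 0%N) ->
  ~ forall i, step P (run i) (run i.+1).
Proof.
move=> inv0 steps; have inv i : state_inv (run i).
  by elim: i => // i /(step_inv (steps i))[].
have decr i : (rank (run i) + i <= rank (run 0%N))%N.
  elim: i => [|i IH]; first by rewrite addn0.
  have [_ lt_i] := step_inv (steps i) (inv i).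
  by apply: leq_trans IH; rewrite addnS -addSn leq_add2r.
by have := decr (rank (run 0%N)).+1; rewrite addnS ltnNge leq_addl.
Qed.

Lemma progress st : state_inv st -> ~ stops P st -> exists st', step P st st'.
Proof.
case: st => [S x [SP cS] nstop|p S x [SP pP inv] _].
  have [p pP px] : exists2 p, p \in P & ~~ soc_le x p.
    apply: contrapT => none; apply: nstop => p pP.
    by apply: contrapT => /negP px; apply: none; exists p.
  have [dom|ndom] := pselect (forall q, q \in S -> soc_le p q).
    by eexists; exact: step_dominated pP px dom.
  have [q qS] : exists q, q \in S by case: cS => _ _ [l _ /barycenter_in].
  have [s [t [tS _]]] := enumerates_exists qS.
  have entS : entering P S x p by [].
  have [z0|/eqP z0] := eqVneq (enorm (zvec t p)) 0; last first.
    by eexists; exact: step_independent entS tS z0.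
  have [k kdep] := dependent_index_exists t p (hd x).
  by eexists; exact: step_dependent entS tS z0 kdep.
have [S0|[q qS]] := fset_0Vmem S.
  by rewrite S0; eexists; exact: step_exhausted.
have [s [t [tS _]]] := enumerates_exists qS.
have [xp part] := partial_exists tS inv.
have [xf full] := full_exists tS inv.
have [le_x|lt_x] := leP xf xp%:E; last first.
  by eexists; exact: step_full tS part full lt_x.
have [k part_k] := part.1.
by eexists; exact: step_partial tS part part_k full le_x.
Qed.

Lemma output_correct st : state_inv st -> stops P st -> correct_output P st.
Proof.
case: st => // S x [SP cS] feas.
have restrict y : Inf_feasible P y -> Inf_feasible S y.
  by move=> yP q /(fsubsetP SP)/yP.
have InfP : Inf P x.
  by split=> // y /restrict yS; case: (certified_optimal cS yS).
split=> //; split=> //; first exact: certified_support cS.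
have InfS := certified_Inf cS.
apply/seteqP; split=> y [yfeas y_opt].
  rewrite (_ : y = x) //; apply: (certified_optimal cS yfeas).2.
  by apply: le_anti; rewrite (InfS.2 _ yfeas) (y_opt _ InfS.1).
rewrite (_ : y = x) //; apply: (certified_optimal cS (restrict _ yfeas)).2.
by apply: le_anti; rewrite (InfP.2 _ yfeas) (y_opt _ InfP.1).
Qed.

End Algorithm.

Theorem theorem11 (R : realType) (d : nat) (P S0 : {fset 'cV[R]_(1 + d)})
  (x0 : 'cV[R]_(1 + d)) :
  (S0 `<=` P)%fset ->
  dual_feasible_pair S0 x0 ->
  solves_in_finitely_many_iterations P (Check S0 x0).
Proof.
move=> S0P feas; have inv0 : state_inv P (Check S0 x0).
  by split=> //; exact: dual_feasible_certified.
split=> [[run [run0 steps]]|st reach|st reach].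
- by apply: (@no_infinite_run _ _ P run) => //; rewrite run0.
- exact: progress (reachable_inv reach inv0).
- exact: output_correct (reachable_inv reach inv0).
Qed.
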